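(* Let $\Omega\subset\mathbb{R}^2$ be a domain and let $S=\{(x,y,u(x,y)) : (x,y)\in\Omega\}$ be an open $C^1$ H-minimal graph over $\Omega$ with no characteristic points, whose unit horizontal Gauss map $\nu_X=(\bar p,\bar q)$ has components in $W^{1,1}(\Omega)$. Then the integral curves of $\nu_X^\perp$ are straight lines, and $S$ can be locally parameterized by $$(s,r)\mapsto\bigl(\gamma_1(s)+r\gamma_2'(s),\ \gamma_2(s)-r\gamma_1'(s),\ h(s,r)\bigr),\qquad h(s,r)=h_0(s)-\frac r2\langle\gamma(s),\gamma'(s)\rangle,$$ where $\gamma=(\gamma_1,\gamma_2)$ is an integral curve of $\nu_X$ and $h_0$ is a function of $s$. Moreover, if there exists $\epsilon>0$ such that $d(\Omega,\gamma)>\epsilon>0$, then $h_0\in C^1$ and $\gamma\in C^2$.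
   Context: The Heisenberg group $\mathbb{H}^1$ is $\mathbb{R}^3$ with coordinates $(x,y,t)$ and the vector fields $X_1=\partial_x-\frac y2\partial_t$, $X_2=\partial_y+\frac x2\partial_t$, $T=\partial_t$. For a $C^1$ graph $S$: $t=u(x,y)$ over $\Omega\subset\mathbb{R}^2$ put $p=X_1(t-u(x,y))$ and $q=X_2(t-u(x,y))$. Characteristic points are those where $p=q=0$. At noncharacteristic points the unit horizontal Gauss map is $\nu_X=\bar p X_1+\bar q X_2$ with $\bar p=p/\sqrt{p^2+q^2}$, $\bar q=q/\sqrt{p^2+q^2}$; it is viewed as the vector field $(\bar p,\bar q)$ on $\Omega$. For $v=(a,b)\in\mathbb{R}^2$, $v^\perp=(b,-a)$. A $C^1$ graph $S$ over $\Omega$ is H-minimal if $\int_\Omega \bar p\,\phi_x+\bar q\,\phi_y\,dx\,dy=0$ for all $\phi\in C_0^\infty(\Omega)$. An integral curve $\gamma$ of $\nu_X$ in the plane is called a seed curve (it is parameterized by arc length since $|\nu_X|=1$). Horizontal thickness: suppose an open set $\Omega$ is parameterized by $F(s,r)=(\gamma_1(s)+r\gamma_2'(s),\gamma_2(s)-r\gamma_1'(s))$, with $\gamma$ a seed curve. Let $$d(s)=\min\bigl\{\sup\{r_1>0: F(s,r)\in\Omega\ \forall r\in(0,r_1)\},\ \sup\{r_2>0: F(s,r)\in\Omega\ \forall r\in(-r_2,0)\}\bigr\},$$ and $d(\Omega,\gamma)=\inf\{d(s):\gamma(s)\in\Omega\}$. *)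

(* Defs.v *)
From HB Require Import structures.
From mathcomp Require Export all_boot all_order all_algebra.
From mathcomp Require Export all_classical all_reals all_analysis.

Set Implicit Arguments.
Unset Strict Implicit.
Unset Printing Implicit Defensive.

Export Order.TTheory GRing.Theory Num.Theory.
Export numFieldNormedType.Exports.

Local Open Scope classical_set_scope.
Local Open Scope ring_scope.

(* [Cn k A f]: f is of class C^k on A.  Meaningful only for A open, in which case
   the values of f outside A play no role; all directional derivatives are
   required, which on the finite-dimensional spaces used here (R and R * R) is
   the same as requiring the partial derivatives. *)
Fixpoint Cn (R : realType) (V W : normedModType R) (k : nat) (A : set V)
    (f : V -> W) : Prop :=
  (forall x, A x -> {for x, continuous f}) /\
  (if k is k'.+1 then
     forall v : V, (forall x, A x -> derivable f x v) /\ Cn k' A ('D_v f)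
   else True).

Section Plane.
Variable R : realType.

Definition domain (Omega : set (R * R)) : Prop :=
  [/\ open Omega, connected Omega & Omega !=set0].

Definition e1 : R * R := (1, 0).
Definition e2 : R * R := (0, 1).

Definition dot (v w : R * R) : R := v.1 * w.1 + v.2 * w.2.

Definition perp (v : R * R) : R * R := (v.2, - v.1).

Definition lebesgue2 :
    {measure set (measurableTypeR R * measurableTypeR R) -> \bar R} :=
  ((@lebesgue_measure R) \x (@lebesgue_measure R))%E.

(* C_0^oo(Omega), with functions extended by zero to the whole plane. *)
Definition test_function (Omega : set (R * R)) (phi : R * R -> R) : Prop :=
  [/\ forall k, Cn k [set: R * R] phi,
      compact (closure [set z | phi z != 0]) &
      closure [set z | phi z != 0] `<=` Omega].

Definition weak_derivative (Omega : set (R * R)) (v : R * R)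
    (f g : R * R -> R) : Prop :=
  forall phi, test_function Omega phi ->
    (\int[lebesgue2]_(z in Omega) (f z * 'D_v phi z)%:E =
     - \int[lebesgue2]_(z in Omega) (g z * phi z)%:E)%E.

Definition W11 (Omega : set (R * R)) (f : R * R -> R) : Prop :=
  lebesgue2.-integrable Omega (EFin \o f) /\
  forall v, v = e1 \/ v = e2 ->
    exists2 g : R * R -> R,
      lebesgue2.-integrable Omega (EFin \o g) & weak_derivative Omega v f g.

Definition open_interval (I : set R) : Prop := open I /\ is_interval I.

Definition integral_curve (Omega : set (R * R)) (X : R * R -> R * R)
    (I : set R) (c : R -> R * R) : Prop :=
  open_interval I /\
  forall s, I s -> Omega (c s) /\ is_derive s 1 c (X (c s)).

(* nuX and its rotation are unit fields, so an integral curve lying on a line runs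
   along it at constant velocity. *)
Definition straight (I : set R) (c : R -> R * R) : Prop :=
  exists a v : R * R, v != 0 /\ forall s, I s -> c s = a + s *: v.

End Plane.

Section Heisenberg.
Variable R : realType.

(* The point (x, y, t) of H^1 is ((x, y), t). *)
Definition X1 (f : R * R * R -> R) (w : R * R * R) : R :=
  'D_(e1 R, 0) f w - w.1.2 / 2 * 'D_(0, 1) f w.

Definition X2 (f : R * R * R -> R) (w : R * R * R) : R :=
  'D_(e2 R, 0) f w + w.1.1 / 2 * 'D_(0, 1) f w.

Definition graph_of (Omega : set (R * R)) (u : R * R -> R) : set (R * R * R) :=
  [set w | Omega w.1 /\ w.2 = u w.1].

Definition defining_fun (u : R * R -> R) (w : R * R * R) : R := w.2 - u w.1.

Definition p (u : R * R -> R) (z : R * R) : R := X1 (defining_fun u) (z, u z).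
Definition q (u : R * R -> R) (z : R * R) : R := X2 (defining_fun u) (z, u z).

Definition characteristic (u : R * R -> R) (z : R * R) : Prop :=
  p u z = 0 /\ q u z = 0.

Definition pbar (u : R * R -> R) (z : R * R) : R :=
  p u z / Num.sqrt (p u z ^+ 2 + q u z ^+ 2).
Definition qbar (u : R * R -> R) (z : R * R) : R :=
  q u z / Num.sqrt (p u z ^+ 2 + q u z ^+ 2).

Definition nuX (u : R * R -> R) (z : R * R) : R * R := (pbar u z, qbar u z).

Definition Hminimal (Omega : set (R * R)) (u : R * R -> R) : Prop :=
  forall phi, test_function Omega phi ->
    (\int[@lebesgue2 R]_(z in Omega)
       (pbar u z * 'D_(e1 R) phi z + qbar u z * 'D_(e2 R) phi z)%:E = 0)%E.

Definition seed_curve (Omega : set (R * R)) (u : R * R -> R)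
    (I : set R) (gamma : R -> R * R) : Prop :=
  integral_curve Omega (nuX u) I gamma.

Definition F (gamma : R -> R * R) (z : R * R) : R * R :=
  gamma z.1 + z.2 *: perp ((gamma^`())%classic z.1).

Definition h (gamma : R -> R * R) (h0 : R -> R) (z : R * R) : R :=
  h0 z.1 - z.2 / 2 * dot (gamma z.1) ((gamma^`())%classic z.1).

Definition Phi (gamma : R -> R * R) (h0 : R -> R) (z : R * R) : R * R * R :=
  (F gamma z, h gamma h0 z).

(* Psi restricted to the open set U is a homeomorphism onto a relatively open
   subset of S. *)
Definition local_parameterization (S : set (R * R * R)) (U : set (R * R))
    (Psi : R * R -> R * R * R) : Prop :=
  [/\ open U,
      forall z, U z -> {for z, continuous Psi},
      set_inj U Psi &
      forall V, open V -> V `<=` U ->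
        exists2 W, open W & Psi @` V = S `&` W].

(* The parameter domain U lies over I and contains I x {0}, so that the
   rule through each point of gamma is (partly) covered. *)
Definition seed_parameterization (Omega : set (R * R)) (u : R * R -> R)
    (I : set R) (gamma : R -> R * R) (h0 : R -> R) (U : set (R * R)) : Prop :=
  [/\ seed_curve Omega u I gamma,
      U `<=` [set z | I z.1],
      forall s, I s -> U (s, 0) &
      local_parameterization (graph_of Omega u) U (Phi gamma h0)].

(* Suprema and infima are taken in the extended reals, as Omega may contain whole
   half-lines. *)
Definition thickness_at (Omega : set (R * R)) (gamma : R -> R * R) (s : R) :
    \bar R :=
  Order.min
    (ereal_sup [set r1%:E | r1 in [set r1 : R | 0 < r1 /\
       forall r : R, 0 < r < r1 -> Omega (F gamma (s, r))]])
    (ereal_sup [set r2%:E | r2 in [set r2 : R | 0 < r2 /\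
       forall r : R, - r2 < r < 0 -> Omega (F gamma (s, r))]]).

Definition thickness (Omega : set (R * R)) (I : set R) (gamma : R -> R * R) :
    \bar R :=
  ereal_inf [set thickness_at Omega gamma s | s in
    [set s | I s /\ Omega (gamma s)]].

End Heisenberg.

(* Main.v *)
(* nu_X is a continuous unit field whose distributional divergence vanishes, so by a weak
   Poincare lemma its rotation nu_X^perp is locally the gradient of a C^1 function psi
   with |grad psi| = 1.  Such a psi is 1-Lipschitz and grad psi is constant along its
   gradient curves, which are therefore straight.  Conversely, a maximum point w of
   psi - |. - z| on the boundary of a box around z satisfies psi(w) = psi(z) + |w - z|, so
   that grad psi is constant on the segment from z to w.

   Seed curves are level curves of psi; one through a given point is obtained from the
   intermediate value theorem and parameterized by arc length.  Since psi(F(s,r)) =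
   psi(gamma(s)) + r, the map F is inverted by r = psi - psi(gamma) and by the projection
   z - r grad psi(z) onto the level curve.

   Along a ruling, u(F(s,r)) = u(gamma(s)) - (r/2) <gamma, gamma'>.  The increment in s of
   this identity, at a fixed r < 0, is linear in the increment of gamma' with a nonzero
   coefficient, and u is C^1; hence gamma'' exists and is continuous. *)

Require Import Defs.
From mathcomp Require Import measurable_realfun ring lra.

Set Implicit Arguments.
Unset Strict Implicit.
Unset Printing Implicit Defensive.

Local Open Scope classical_set_scope.
Local Open Scope ring_scope.

(** * Derivatives and functions of class C^k *)

(** The obstacle is that nu_X is merely continuous: integral curves of such a field may branch, and
    its divergence exists only in the weak sense. Hence curves are produced from psi instead of by
    solving differential equations: rulings by maximization, seed curves as graphs of an implicit
    function. The Poincare lemma needs no mollification: products a(x) b(y) as test functions reduce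
    it to the one-dimensional du Bois-Reymond lemma, used once per variable, and give zero flux of
    nu_X through rectangles. First-order expansions are exact identities with a secant gradient that
    is continuous at the base point ([C1_slope]); this matters in the last step, where the points on
    the rulings are only known to depend continuously on s. The sign r < 0 there comes from the
    coefficient, which in the limit is r (r/2 - |(p, q)|): at a noncharacteristic point it cannot
    vanish for r < 0, whereas for r > 0 it might. *)

Lemma near_eq_continuous (T U : topologicalType) (f f' : T -> U) s :
  {near s, f =1 f'} -> {for s, continuous f} -> {for s, continuous f'}.
Proof.
move=> N cf; have H : f' @ s --> f s.
  by apply: cvg_trans cf; exact: near_eq_cvg.
by rewrite (nbhs_singleton N) in H.
Qed.

Lemma is_deriveP (R : realType) (V W : normedModType R) (f : V -> W) (x v : V) (d : W) :
  is_derive x v f d <->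
  (fun h : R => h^-1 *: ((f \o shift x) (h *: v) - f x)) @ 0^' --> d.
Proof.
split=> [[df <-]|H]; first exact: df.
split; first by apply/cvg_ex; exists d.
by apply/cvg_lim => //; exact: H.
Qed.

Lemma is_derive_continuous (R : realType) (V : normedModType R) (f : R -> V) (x : R) (df : V) :
  is_derive x 1 f df -> {for x, continuous f}.
Proof. by case=> d _; apply/differentiable_continuous/derivable1_diffP. Qed.

Lemma is_derive_e1 (R : realType) (f : R * R -> R) (z : R * R) d :
  is_derive z (e1 R) f d <-> is_derive z.1 (1 : R) (fun x => f (x, z.2)) d.
Proof.
case: z => x y /=.
have E : (fun h : R => h^-1 *: ((f \o shift (x, y)) (h *: e1 R) - f (x, y))) =
    (fun h : R => h^-1 *: (((fun x => f (x, y)) \o shift x) (h *: (1 : R)) - f (x, y))).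
  apply/funext => h /=; congr (_ *: (f _ - _)).
  by apply: injective_projections; rewrite /= ?scaler0 ?add0r.
by split=> /is_deriveP H; apply/is_deriveP; [rewrite -E|rewrite E].
Qed.

Lemma is_derive_e2 (R : realType) (f : R * R -> R) (z : R * R) d :
  is_derive z (e2 R) f d <-> is_derive z.2 (1 : R) (fun y => f (z.1, y)) d.
Proof.
case: z => x y /=.
have E : (fun h : R => h^-1 *: ((f \o shift (x, y)) (h *: e2 R) - f (x, y))) =
    (fun h : R => h^-1 *: (((fun y => f (x, y)) \o shift y) (h *: (1 : R)) - f (x, y))).
  apply/funext => h /=; congr (_ *: (f _ - _)).
  by apply: injective_projections; rewrite /= ?scaler0 ?add0r.
by split=> /is_deriveP H; apply/is_deriveP; [rewrite -E|rewrite E].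
Qed.

Section CnTheory.
Variables (R : realType) (V : normedModType R).

Lemma CnW (W : normedModType R) k (A : set V) (f : V -> W) :
  Cn k.+1 A f -> Cn k A f.
Proof.
elim: k f => [|k IH] f; first by case.
by case=> cf df; split=> // v; have [dfv /IH] := df v.
Qed.

Lemma Cn_cst (W : normedModType R) k (c : W) : Cn k setT (fun _ : V => c).
Proof.
elim: k c => [|k IH] c; split=> //; try by move=> *; exact: cvg_cst.
move=> v; split=> [*|]; first exact: derivable_cst.
have -> : 'D_v (fun _ : V => c) = fun _ => 0.
  by apply/funext => x; rewrite derive_cst.
exact: IH.
Qed.

Lemma CnD (W : normedModType R) k (f g : V -> W) :
  Cn k setT f -> Cn k setT g -> Cn k setT (fun x => f x + g x).
Proof.
elim: k f g => [|k IH] f g [cf df] [cg dg]; split=> //.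
- by move=> x _; apply: cvgD; [exact: cf|exact: cg].
- by move=> x _; apply: cvgD; [exact: cf|exact: cg].
move=> v; have [df1 df2] := df v; have [dg1 dg2] := dg v; split=> [x _|].
  by apply: derivableD; [exact: df1|exact: dg1].
have -> : 'D_v (fun x : V => f x + g x) = fun x => 'D_v f x + 'D_v g x.
  by apply/funext => x; rewrite deriveD//; [exact: df1|exact: dg1].
exact: IH.
Qed.

Lemma CnM k (f g : V -> R) :
  Cn k setT f -> Cn k setT g -> Cn k setT (fun x => f x * g x).
Proof.
elim: k f g => [|k IH] f g [cf df] [cg dg]; split=> //.
- by move=> x _; apply: cvgM; [exact: cf|exact: cg].
- by move=> x _; apply: cvgM; [exact: cf|exact: cg].
move=> v; have [df1 df2] := df v; have [dg1 dg2] := dg v; split=> [x _|].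
  by apply: derivableM; [exact: df1|exact: dg1].
have -> : 'D_v (fun x : V => f x * g x) =
    fun x => f x * 'D_v g x + g x * 'D_v f x.
  by apply/funext => x; rewrite deriveM//; [exact: df1|exact: dg1].
apply: CnD; apply: IH => //; apply: CnW; by split.
Qed.

(** [l] is the linear part of [L]. Derivatives of [f \o L] are derivatives of [f] in the direction
    [l v], composed with [L], so the induction closes. *)
Lemma Cn_comp_affine k (f : R -> R) (L : V -> R) (l : V -> R) :
  (forall z v t, L (t *: v + z) = t * l v + L z) -> continuous L ->
  Cn k setT f -> Cn k setT (f \o L).
Proof.
move=> Ll cL; elim: k f => [|k IH] f [cf df]; split=> //.
- by move=> x _; apply: continuous_comp; [exact: cL|exact: cf].
- by move=> x _; apply: continuous_comp; [exact: cL|exact: cf].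
have E v x : (fun h : R => h^-1 *: (((f \o L) \o shift x) (h *: v) - (f \o L) x))
    = (fun h : R => h^-1 *: ((f \o shift (L x)) (h *: l v) - f (L x))).
  by apply/funext => t /=; rewrite Ll.
move=> v; have [df1 df2] := df (l v); split=> [x _|].
  by rewrite /derivable E; exact: df1.
have -> : 'D_v (f \o L) = 'D_(l v) f \o L.
  by apply/funext => x; rewrite /derive E.
exact: IH.
Qed.

End CnTheory.

Section CnLine.
Variables (R : realType) (W : normedModType R).
Implicit Types (I : set R) (f : R -> W).

Lemma Cn_eq_on k I f f' : open I -> (forall s, I s -> f s = f' s) ->
  Cn k I f -> Cn k I f'.
Proof.
move=> oI; have N f1 f2 s : (forall t, I t -> f1 t = f2 t) -> I s -> {near s, f1 =1 f2}.
  by move=> E Is; apply: filterS (open_nbhs_nbhs (conj oI Is)) => t; exact: E.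
elim: k f f' => [|k IH] f f' ff' [cf df]; split=> //.
- by move=> s Is; exact: near_eq_continuous (N _ _ _ ff' Is) (cf s Is).
- by move=> s Is; exact: near_eq_continuous (N _ _ _ ff' Is) (cf s Is).
move=> v; have [dfv Cf] := df v; split=> [s Is|].
  exact: near_eq_derivable (N _ _ _ ff' Is) (dfv s Is).
by apply: IH Cf => s Is; exact: near_eq_derive (N _ _ _ ff' Is).
Qed.

Lemma Cn_scale_on k I f (a : R) : open I -> Cn k I f -> Cn k I (fun s => a *: f s).
Proof.
move=> oI; elim: k f => [|k IH] f [cf df]; split=> //.
- by move=> s Is; apply: cvgZl_tmp; exact: cf.
- by move=> s Is; apply: cvgZl_tmp; exact: cf.
move=> v; have [dfv Cf] := df v; split=> [s Is|].
  by apply: derivableZ; exact: dfv.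
apply: (Cn_eq_on (f := fun s => a *: 'D_v f s)) => // [s Is|]; last exact: IH.
by rewrite deriveZ//; exact: dfv.
Qed.

(** In one dimension the derivative in direction [v] is [v *: f'], so a single function accounts for
    all the directional derivatives that [Cn] asks for. *)
Lemma CnS_line k I f f' : open I -> (forall s, I s -> is_derive s (1 : R) f (f' s)) ->
  Cn k I f' -> Cn k.+1 I f.
Proof.
move=> oI ff' Cf'; split=> [s Is|v].
  exact: is_derive_continuous (ff' s Is).
have E s : I s -> is_derive s v f (v *: f' s).
  move=> Is; have [d1 <-] := ff' s Is; split.
    by apply: diff_derivable; apply/derivable1_diffP.
  rewrite deriveE; last exact/derivable1_diffP.
  by rewrite deriv1E// derive1E.
split=> [s /E[]//|].
apply: (Cn_eq_on (f := fun s => v *: f' s)) => // [s /E[]//|].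
exact: Cn_scale_on.
Qed.

End CnLine.

(** * Smooth bumps and the one-dimensional du Bois-Reymond lemma *)

Section Bump.
Variable R : realType.

(** Differentiating exp(-1/x) produces powers of 1/x. With all powers included, the family is stable
    under derivation up to linear combinations, and smoothness is one induction over all [n]. *)
Definition flat (n : nat) (x : R) : R :=
  if 0 < x then x^-1 ^+ n * expR (- x^-1) else 0.

Lemma flat_ge0 n x : 0 <= flat n x.
Proof.
rewrite /flat; case: ifPn => // x0.
by rewrite mulr_ge0 ?expR_ge0// exprn_ge0// invr_ge0 ltW.
Qed.

(** With t = 1/x this is t^(n+1) <= (n+1)! e^t. The difference quotient of [flat n] at 0 is
    [flat n.+1], which the bound sends to 0. *)
Lemma flat_le n x : flat n x <= n.+1`!%:R * `|x|.
Proof.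
rewrite /flat; case: ifPn => [x0|_]; last by rewrite mulr_ge0.
have t0 : 0 < x^-1 by rewrite invr_gt0.
rewrite (gtr0_norm x0) expRN ler_pdivrMr ?expR_gt0//.
have := expR_ge1Dxn n (ltW t0).
have F0 : 0 < n.+1`!%:R :> R by rewrite ltr0n fact_gt0.
move=> H.
have {}H : x^-1 ^+ n.+1 <= n.+1`!%:R * expR x^-1.
  rewrite mulrC -ler_pdivrMr//; apply: le_trans H.
  by rewrite lerDr.
rewrite -(ler_pM2r t0) -exprSr (le_trans H)//.
by rewrite mulrAC mulfK ?gt_eqF.
Qed.

Lemma is_derive_flat n (x : R) :
  is_derive x 1 (flat n) (flat n.+2 x - n%:R * flat n.+1 x).
Proof.
have [x0|x0|->] := ltgtP x 0.
- have E : {near x, (fun _ => 0) =1 flat n}.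
    near=> y; rewrite /flat ifF//; apply/negbTE; rewrite -leNgt ltW//.
    by near: y; exact: lt_nbhsl.
  apply: (near_eq_is_derive (f := fun=> 0)) => //.
  rewrite /flat !ifF ?mulr0 ?subr0; [|by apply/negbTE; rewrite -leNgt ltW..].
  exact: is_derive_cst.
- have E : {near x, (fun y : R => y^-1 ^+ n * expR (- y^-1)) =1 flat n}.
    near=> y; rewrite /flat ifT//.
    by near: y; exact: lt_nbhsr.
  apply: (near_eq_is_derive (f := fun y : R => y^-1 ^+ n * expR (- y^-1))) => //.
  rewrite /flat x0.
  have xn0 : x != 0 by rewrite gt_eqF.
  have dV : is_derive x (1 : R) (fun y : R => y^-1) (- x^-1 ^+ 2).
    have := @is_deriveV R id x 1 1 xn0 _.
    by rewrite /= /GRing.scale/= mulr1 exprVn; apply.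
  have dX : is_derive x (1 : R) (fun y : R => y^-1 ^+ n)
      (n%:R * x^-1 ^+ n.-1 * (- x^-1 ^+ 2)).
    apply: (@is_derive1_comp _ (fun y => y ^+ n) (fun y => y^-1)).
    by split; [exact: exprn_derivable|rewrite exp_derive /GRing.scale/= mulr1].
  have dE : is_derive x (1 : R) (fun y : R => expR (- y^-1)) (expR (- x^-1) * x^-1 ^+ 2).
    apply: (@is_derive1_comp _ expR (fun y => - y^-1)).
    by rewrite -[X in is_derive _ _ _ X]opprK; exact: is_deriveN.
  apply: (is_derive_eq (is_deriveM dX dE)).
  rewrite /GRing.scale/=.
  case: n {E dX} => [|n]; rewrite ?expr0 /=; [|rewrite !exprSr]; ring.
- have f0 m : flat m 0 = 0 by rewrite /flat ltxx.
  have Q : (fun h : R => h^-1 *: ((flat n \o shift 0) (h *: (1:R)) - flat n 0))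
      @ 0^' --> (0 : R).
    apply/cvgrPdist_le => /= e e0; near=> h.
    rewrite f0 subr0 addr0 sub0r normrN.
    rewrite [h *: 1](_ : _ = h); last by rewrite /GRing.scale/= mulr1.
    have -> : h^-1 *: flat n h = flat n.+1 h.
      rewrite /flat /GRing.scale/=; case: ifPn => _; last by rewrite mulr0.
      by rewrite exprS mulrA.
    rewrite (ger0_norm (flat_ge0 _ _)) (le_trans (flat_le _ _))//.
    rewrite -ler_pdivlMl ?ltr0n ?fact_gt0//.
    near: h; apply: dnbhs0_le; rewrite mulr_gt0// invr_gt0 ltr0n fact_gt0.
  rewrite !f0 mulr0 subr0; split.
    by apply/cvg_ex; exists 0; exact: Q.
  by apply/cvg_lim => //; exact: Q.
Unshelve. all: by end_near. Qed.

Lemma Cn_flat k n : Cn k setT (flat n).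
Proof.
have cont m (x : R) : {for x, continuous (flat m)}.
  apply/differentiable_continuous/derivable1_diffP.
  by case: (is_derive_flat m x).
elim: k n => [|k IH] n; first by split.
apply: (CnS_line openT (fun x _ => is_derive_flat n x)).
have -> : (fun x => flat n.+2 x - n%:R * flat n.+1 x) =
    (fun x => flat n.+2 x + (- n%:R) * flat n.+1 x).
  by apply/funext => x; rewrite mulNr.
by apply: CnD => //; apply: CnM => //; exact: Cn_cst.
Qed.

Definition bump (d x : R) : R := flat 0 (x + d) * flat 0 (- x + d).

Lemma bump_ge0 d x : 0 <= bump d x.
Proof. by rewrite mulr_ge0 ?flat_ge0. Qed.

Lemma bump0_gt0 d : 0 < d -> 0 < bump d 0.
Proof.
by move=> d0; rewrite /bump oppr0 add0r /flat d0 !mulr_gt0// ?exprn_gt0 ?invr_gt0 ?expR_gt0.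
Qed.

Lemma bump_eq0 d x : d <= `|x| -> bump d x = 0.
Proof.
rewrite /bump /flat => dx; case: ifPn; rewrite ?mul0r// => xd.
rewrite ifF ?mulr0//; apply/negbTE; rewrite -leNgt.
by move: dx; case: (ger0P x); lra.
Qed.

Lemma Cn_bump k d c : Cn k setT (fun x => bump d (x - c)).
Proof.
apply: CnM.
  apply: (@Cn_comp_affine R R k (flat 0) (fun x => x - c + d) id _ _ (Cn_flat k 0)).
    by move=> z v t; rewrite /GRing.scale/=; ring.
  by move=> x; apply: cvgD; [apply: cvgB; [exact: cvg_id|exact: cvg_cst]|exact: cvg_cst].
apply: (@Cn_comp_affine R R k (flat 0) (fun x => - (x - c) + d) (fun x => - x) _ _ (Cn_flat k 0)).
  by move=> z v t; rewrite /GRing.scale/=; ring.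
move=> x; apply: cvgD; [apply: cvgN|exact: cvg_cst].
by apply: cvgB; [exact: cvg_id|exact: cvg_cst].
Qed.

End Bump.

(** * Primitives of continuous functions *)

Section Primitive.
Variable R : realType.
Notation mu := (@lebesgue_measure R).
Implicit Types (f g : R -> R) (a b x : R).

Lemma MVT_is_derive f df a b : a <= b ->
  (forall x, a <= x <= b -> is_derive x 1 f (df x)) ->
  exists2 c, a <= c <= b & f b - f a = df c * (b - a).
Proof.
move=> ab fdf.
have [|||c] := @MVT_segment R f df a b => //.
- by move=> x; rewrite in_itv/= => /andP[/ltW ax /ltW xb]; apply: fdf; rewrite ax.
- apply: continuous_in_subspaceT => x; rewrite inE/= in_itv/= => /fdf.
  exact: is_derive_continuous.
- by rewrite in_itv/=; exists c.
Qed.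

Lemma is_derive0_eq f a b : a <= b ->
  (forall x, a <= x <= b -> is_derive x 1 f 0) -> f a = f b.
Proof.
move=> ab /(MVT_is_derive ab)[c _]; rewrite mul0r => /eqP.
by rewrite subr_eq0 => /eqP.
Qed.

Lemma continuous_integrable f a b : continuous f ->
  mu.-integrable `[a, b] (EFin \o f).
Proof.
move=> cf; apply: continuous_compact_integrable; first exact: segment_compact.
exact: continuous_subspaceT.
Qed.

(* The lower bound moves with [x], so that no orientation of the integral has to be
   discussed. *)
Definition primitive f x : R :=
  \int[mu]_(t in `[- `|x| - 1, x]) f t - \int[mu]_(t in `[- `|x| - 1, 0]) f t.

(** One lower bound [- M] serves all [x] in a bounded set, which brings [primitive] under the
    fundamental theorem with a fixed lower end. *)
Lemma primitiveE f M x : continuous f -> `|x| + 1 <= M ->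
  primitive f x = \int[mu]_(t in `[- M, x]) f t - \int[mu]_(t in `[- M, 0]) f t.
Proof.
move=> cf xM; rewrite /primitive.
have H y : - `|x| - 1 <= y -> \int[mu]_(t in `[- M, y]) f t =
   \int[mu]_(t in `[- M, - `|x| - 1]) f t + \int[mu]_(t in `[- `|x| - 1, y]) f t.
  move=> yx; apply/eqP; rewrite addrC -subr_eq; apply/eqP.
  rewrite (@Rintegral_itvB _ f (BLeft (- M)) (BRight y) (- `|x| - 1)).
  - rewrite Rintegral_itv_obnd_cbnd//.
    apply: integrableS (continuous_integrable (- M) y cf) => //.
    by apply: subset_itvScc; rewrite bnd_simp//; lra.
  - exact: continuous_integrable.
  - by rewrite bnd_simp; lra.
  - by rewrite bnd_simp.
rewrite (H x) ?(H 0).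
- ring.
- by have := normr_ge0 x; lra.
- by have := ler_norm (- x); rewrite normrN; lra.
Qed.

Lemma is_derive_primitive f x : continuous f -> is_derive x 1 (primitive f) (f x).
Proof.
move=> cf; pose M : R := `|x| + 2; pose I0 := \int[mu]_(t in `[- M, 0]) f t.
pose F := fun y : R => \int[mu]_(t in `[- M, y]) f t.
have E : {near x, (fun y => F y - I0) =1 primitive f}.
  near=> y; rewrite (@primitiveE f M)// /M.
  have : `|y - x| < 1 by near: y; rewrite /=; apply: cvgr_distC_lt; first exact: cvg_id.
  by move=> H; have := ler_normD (y - x) x; rewrite subrK; lra.
apply: (near_eq_is_derive (f := fun y : R => F y - I0)) => //.
rewrite -[f x]subr0; apply: is_deriveB.
have [||||d1 d2] := @continuous_FTC1_closed R f (- M) x (x + 1).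
- lra.
- exact: continuous_integrable.
- by rewrite /M; have := ler_norm (- x); rewrite normrN; lra.
- exact: cf.
by split; rewrite -?derive1E.
Unshelve. all: by end_near. Qed.

Lemma integral_is_derive f F a b : a <= b -> continuous f ->
  (forall x, a <= x <= b -> is_derive x 1 F (f x)) ->
  \int[mu]_(t in `[a, b]) f t = F b - F a.
Proof.
rewrite le_eqVlt => /predU1P[->|ab] cf Ff.
  by rewrite set_itv1 Rintegral_set1 subrr.
rewrite /Rintegral (@continuous_FTC2 _ f F)//.
- exact: continuous_subspaceT.
- split.
  + by move=> x; rewrite in_itv/= => /andP[/ltW ax /ltW xb]; have [] := Ff x; rewrite ?ax ?xb.
  + apply: cvg_at_right_filter; apply: (@is_derive_continuous _ _ _ _ (f a)).
    by apply: Ff; rewrite lexx ltW.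
  + apply: cvg_at_left_filter; apply: (@is_derive_continuous _ _ _ _ (f b)).
    by apply: Ff; rewrite lexx ltW.
- move=> x; rewrite in_itv/= => /andP[/ltW ax /ltW xb]; rewrite derive1E.
  by have [|_ ->] := Ff x; rewrite ?ax ?xb.
Qed.

(** The primitive of [f] is nondecreasing on [a, b] with equal end values, hence constant there, so
    its derivative [f] vanishes inside. *)
Lemma ge0_integral_eq0 f a b x : continuous f ->
  (forall x, a <= x <= b -> 0 <= f x) -> \int[mu]_(t in `[a, b]) f t = 0 ->
  a < x < b -> f x = 0.
Proof.
move=> cf f0 If0 /andP[ax xb].
have ab : a <= b by lra.
have dP (y : R) : is_derive y (1 : R) (primitive f) (f y) by exact: is_derive_primitive.
have mono y z : a <= y -> y <= z -> z <= b -> primitive f y <= primitive f z.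
  move=> ay yz zb; rewrite -subr_ge0.
  have [c /andP[yc cz] ->] := MVT_is_derive yz (fun t _ => dP t).
  by rewrite mulr_ge0 ?subr_ge0// f0//; lra.
have E : primitive f b = primitive f a.
  apply/eqP; rewrite -subr_eq0 -(@integral_is_derive f)//; exact/eqP.
have K y : a <= y <= b -> primitive f y = primitive f a.
  move=> /andP[ay yb]; apply/eqP; rewrite eq_le -{1}E !mono//.
have N : {near x, (fun _ => primitive f a) =1 primitive f}.
  near=> y; rewrite K//; apply/andP; split; apply: ltW; near: y.
    exact: lt_nbhsr.
  exact: lt_nbhsl.
have H := near_eq_is_derive N (is_derive_cst (primitive f a) x (1 : R)).
by case: (dP x) => _ <-; case: H.
Unshelve. all: by end_near. Qed.

End Primitive.

(** * The du Bois-Reymond lemma on an interval *)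

Section DuBoisReymond.
Variable R : realType.
Notation mu := (@lebesgue_measure R).
Implicit Types (f g a A B : R -> R) (l r x : R).

Definition test1 l r a : Prop :=
  (forall k, Cn k setT a) /\
  exists l' r', [/\ l < l', r' < r & forall x, ~ (l' <= x <= r') -> a x = 0].

Lemma continuous_is_derive f g : (forall x, is_derive x (1 : R) f (g x)) ->
  continuous f.
Proof. by move=> fg x; exact: is_derive_continuous (fg x). Qed.

Lemma continuous_bump (d c : R) : continuous (fun x => bump d (x - c)).
Proof. by move=> x; have [cb _] := Cn_bump 0 d c; exact: cb. Qed.

(** Two translates of one bump have the same integral, so a suitable primitive of their difference
    has compact support. *)
Lemma test1_bump_difference l r d x1 x2 :
  0 < d -> l < x1 - d -> x1 + d < r -> l < x2 - d -> x2 + d < r ->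
  exists2 a, test1 l r a &
    forall x, is_derive x (1 : R) a (bump d (x - x1) - bump d (x - x2)).
Proof.
move=> d0 lx1 x1r lx2 x2r.
have db y : is_derive y (1 : R) (primitive (bump d)) (bump d y).
  apply: is_derive_primitive; have := @continuous_bump d 0.
  by under eq_fun do rewrite subr0.
pose H := primitive (bump d).
have dH c x : is_derive x (1 : R) (fun y => H (y - c)) (bump d (x - c)).
  have := @is_derive1_comp _ H (fun y => y - c) x (bump d (x - c)) 1 (db _).
  by rewrite mulr1; apply; rewrite -[X in is_derive _ _ _ X]subr0; exact: is_deriveB.
pose a x := H (x - x1) - H (x - x2).
have da x : is_derive x (1 : R) a (bump d (x - x1) - bump d (x - x2)).
  exact: is_deriveB.
exists a => //; split.
  case=> [|k]; first by split=> // x _; exact: is_derive_continuous (da x).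
  apply: (CnS_line openT (fun x _ => da x)).
  have -> : (fun x => bump d (x - x1) - bump d (x - x2)) =
      (fun x => bump d (x - x1) + (-1) * bump d (x - x2)).
    by apply/funext => x; rewrite mulN1r.
  by apply: CnD; [|apply: CnM; [exact: Cn_cst|]]; exact: Cn_bump.
pose l' := Num.min x1 x2 - d; pose r' := Num.max x1 x2 + d.
have Hconst y z : y <= z -> z <= - d \/ d <= y -> H y = H z.
  move=> yz yzd.
  have dH0 x : y <= x <= z -> is_derive x (1 : R) H 0.
    move=> /andP[yx xz]; have <- : bump d x = 0; last exact: db.
    by apply: bump_eq0; case: yzd => ?; case: (ger0P x); lra.
  exact: (@is_derive0_eq R H y z yz dH0).
exists l', r'; split.
- by rewrite /l'; case: (leP x1 x2); lra.
- by rewrite /r'; case: (leP x1 x2); lra.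
move=> x /negP; rewrite negb_and -!ltNge /a /l' /r'.
have [x12|x21] := leP x1 x2 => /orP[]?.
- by rewrite (Hconst (x - x2) (x - x1)) ?subrr//; lra.
- by rewrite (Hconst (x - x2) (x - x1)) ?subrr//; lra.
- by rewrite (Hconst (x - x1) (x - x2)) ?subrr//; lra.
- by rewrite (Hconst (x - x1) (x - x2)) ?subrr//; lra.
Qed.

(** With P a primitive of [B] and G = A - P, suppose G y1 < m < G y2. A test function [a] whose
    derivative is a bump at y1 minus a bump at y2 makes (m - G) a' nonnegative and positive at y1,
    while the hypothesis makes its integral 0. *)
Lemma du_bois_reymond l r A B : continuous A -> continuous B ->
  (forall a, test1 l r a -> \int[mu]_(t in `[l, r]) (A t * 'D_1 a t + B t * a t) = 0) ->
  forall x1 x2, l < x1 -> x1 <= x2 -> x2 < r ->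
    A x2 - A x1 = \int[mu]_(t in `[x1, x2]) B t.
Proof.
move=> cA cB H x1 x2 lx1 x12 x2r.
pose P := primitive B.
have dP x : is_derive x (1 : R) P (B x) by exact: is_derive_primitive.
rewrite (@integral_is_derive _ B P)//.
pose G x := A x - P x.
have cP := continuous_is_derive dP.
have cG : continuous G.
  by move=> x; apply: cvgB; [exact: cA|exact: cP].
suff K y1 y2 : l < y1 < r -> l < y2 < r -> ~ (G y1 < G y2).
  have y1 : l < x1 < r by lra.
  have y2 : l < x2 < r by lra.
  have /negP := K _ _ y1 y2; have /negP := K _ _ y2 y1.
  by rewrite -!leNgt /G -/P; lra.
move=> /andP[ly1 y1r] /andP[ly2 y2r] Gy.
pose m := (G y1 + G y2) / 2.
have Gm1 : G y1 < m by rewrite /m; lra.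
have Gm2 : m < G y2 by rewrite /m; lra.
have [d [d0 D1 D2 [ld1 dr1 ld2 dr2]]] : exists d, [/\ 0 < d,
   forall x, `|x - y1| < d -> G x < m, forall x, `|x - y2| < d -> m < G x &
   [/\ l < y1 - d, y1 + d < r, l < y2 - d & y2 + d < r]].
  have : \forall d \near 0^'+, [/\ 0 < d,
     forall x, `|x - y1| < d -> G x < m, forall x, `|x - y2| < d -> m < G x &
     [/\ l < y1 - d, y1 + d < r, l < y2 - d & y2 + d < r]].
    have /nbhs_ballP[e1 /= e10 E1] : \forall x \near y1, G x < m.
      by have /cvgr_lt := cG y1; apply.
    have /nbhs_ballP[e2 /= e20 E2] : \forall x \near y2, m < G x.
      by have /cvgr_gt := cG y2; apply.
    near=> d; split.
    - by near: d; exact: nbhs_right_gt.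
    - move=> x xd; apply: E1; rewrite /ball/= distrC; apply: (lt_trans xd).
      by near: d; exact: nbhs_right_lt.
    - move=> x xd; apply: E2; rewrite /ball/= distrC; apply: (lt_trans xd).
      by near: d; exact: nbhs_right_lt.
    - split; [rewrite ltrBrDr -ltrBrDl|rewrite -ltrBrDl|
              rewrite ltrBrDr -ltrBrDl|rewrite -ltrBrDl];
        by near: d; apply: nbhs_right_lt; rewrite subr_gt0.
  by move=> /filter_ex.
have [a ta da] := test1_bump_difference d0 ld1 dr1 ld2 dr2.
have a'E x : 'D_1 a x = bump d (x - y1) - bump d (x - y2).
  by case: (da x).
have ca := continuous_is_derive da.
have ca' : continuous ('D_1 a).
  have -> : 'D_1 a = fun x => bump d (x - y1) - bump d (x - y2) by apply/funext.
  by move=> x; apply: cvgB; exact: continuous_bump.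
pose N x := (m - G x) * 'D_1 a x.
have cN : continuous N.
  by move=> x; apply: cvgM; [apply: cvgB; [exact: cvg_cst|exact: cG]|exact: ca'].
have N0 x : 0 <= N x.
  rewrite /N a'E mulrBr subr_ge0; apply: (@le_trans _ _ 0).
    have [xd|xd] := ltP `|x - y2| d; last by rewrite bump_eq0// mulr0.
    by rewrite mulr_le0_ge0 ?bump_ge0// subr_le0 ltW// D2.
  have [xd|xd] := ltP `|x - y1| d; last by rewrite bump_eq0// mulr0.
  by rewrite mulr_ge0 ?bump_ge0// subr_ge0 ltW// D1.
have [_ [l' [r' [ll' r'r a0]]]] := ta.
have lr : l <= r by lra.
have al : a l = 0 by apply: a0; lra.
have ar : a r = 0 by apply: a0; lra.
(* [Q] vanishes at both ends, and [N] is its derivative minus the integrand of the hypothesis; hence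
   the integral of [N] is 0. *)
pose Q x := (m + P x) * a x.
pose q x := (m + P x) * 'D_1 a x + B x * a x.
have dQ x : is_derive x (1 : R) Q (q x).
  have da' : is_derive x (1 : R) a ('D_1 a x) by rewrite a'E.
  have dmP : is_derive x (1 : R) (fun y => m + P y) (B x).
    by rewrite -[B x]add0r; exact: is_deriveD.
  by apply: (is_derive_eq (is_deriveM dmP da')); rewrite /q /GRing.scale/=; ring.
have cBa : continuous (fun x => B x * a x).
  by move=> x; apply: cvgM; [exact: cB|exact: ca].
have cq : continuous q.
  move=> x; apply: cvgD; last exact: cBa.
  by apply: cvgM; [apply: cvgD; [exact: cvg_cst|exact: cP]|exact: ca'].
have cw : continuous (fun x => A x * 'D_1 a x + B x * a x).
  by move=> x; apply: cvgD; [apply: cvgM; [exact: cA|exact: ca']|exact: cBa].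
have IN : \int[mu]_(t in `[l, r]) N t = 0.
  have NE : N = fun x => q x - (A x * 'D_1 a x + B x * a x).
    by apply/funext => x; rewrite /N /q /G; ring.
  rewrite NE RintegralB//; [|exact: continuous_integrable..].
  rewrite (@integral_is_derive _ q Q)// H//.
  by rewrite /Q al ar !mulr0 !subr0.
have := ge0_integral_eq0 cN (fun x _ => N0 x) IN (_ : l < y1 < r).
rewrite ly1 y1r => /(_ isT); rewrite /N a'E => /eqP.
have -> : bump d (y1 - y2) = 0.
  rewrite bump_eq0// leNgt; apply/negP => /D2; lra.
rewrite subrr subr0 mulf_eq0 subr_eq0 (gt_eqF Gm1)/=.
by rewrite gt_eqF// bump0_gt0.
Unshelve. all: by end_near. Qed.

End DuBoisReymond.

(** * Potentials of weakly closed continuous fields *)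

Section Plane.
Variable R : realType.
Notation mu := (@lebesgue_measure R).
Notation mR := (measurableTypeR R).

(** Measurability on the plane refers to the product sigma-algebra, so an open set is written as a
    countable union of rational boxes. *)
Lemma open_measurable2 (A : set (R * R)) :
  open A -> measurable (A : set (mR * mR)).
Proof.
move=> oA; pose box (q : rat * rat * rat) : set (mR * mR) :=
  `](ratr q.1.1 - ratr q.2 : R), ratr q.1.1 + ratr q.2[ `*`
  `](ratr q.1.2 - ratr q.2 : R), ratr q.1.2 + ratr q.2[.
have -> : A = \bigcup_q (if pselect (box q `<=` A) then box q else set0).
  apply/seteqP; split=> [[x y] Axy|z [q _]]; last by case: pselect => //; exact.
  have /nbhs_ballP[e /= e0 eA] := open_nbhs_nbhs (conj oA Axy).
  have [q /andP[q0 qe]] : exists q, (0 : R) < ratr q < e / 2.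
    by have /rat_in_itvoo[q] : 0 < e / 2; [lra|rewrite in_itv; exists q].
  have [q1 /andP[q11 q12]] : exists q1, x - ratr q < ratr q1 < x + ratr q.
    by have /rat_in_itvoo[q1] : x - ratr q < x + ratr q; [lra|rewrite in_itv; exists q1].
  have [q2 /andP[q21 q22]] : exists q2, y - ratr q < ratr q2 < y + ratr q.
    by have /rat_in_itvoo[q2] : y - ratr q < y + ratr q; [lra|rewrite in_itv; exists q2].
  have bA : box (q1, q2, q) `<=` A.
    move=> [x' y'] [] /=; rewrite !in_itv/= => /andP[? ?] /andP[? ?]; apply: eA.
    by split; rewrite /= /ball/= ltr_norml; lra.
  exists (q1, q2, q) => //; case: pselect => //= bA'.
  by split; rewrite /= in_itv/=; lra.
apply: countable_bigcupT_measurable => // q.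
by case: pselect => //= bA; apply: measurableX; exact: measurable_itv.
Qed.

Lemma continuous_measurable_fun2 (f : R * R -> R) : continuous f ->
  measurable_fun setT (f : mR * mR -> mR).
Proof.
move=> /continuousP cf; apply: (measurability _ (RGenOpens.measurableE R)).
move=> _ [_ [a [b ->] <-]]; rewrite setTI; apply: open_measurable2.
exact/cf/interval_open.
Qed.

Definition box (a b c d : R) : set (R * R) := `[a, b] `*` `[c, d].

Lemma compact_box a b c d : compact (box a b c d).
Proof. by apply: compact_setX; exact: segment_compact. Qed.

Lemma measurable_box a b c d : measurable (box a b c d : set (mR * mR)).
Proof. by apply: measurableX; exact: measurable_itv. Qed.

Lemma continuous_box_bounded (f : R * R -> R) a b c d : continuous f ->
  exists M, forall x y, a <= x <= b -> c <= y <= d -> `|f (x, y)| <= M.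
Proof.
move=> cf.
have : bounded_set (f @` box a b c d).
  apply/compact_bounded/continuous_compact; last exact: compact_box.
  exact: continuous_subspaceT.
move=> [M [_ HM]]; exists (M + 1) => x y xab ycd; apply: (HM (M + 1)).
  by rewrite ltrDl.
by exists (x, y) => //; split; rewrite /= in_itv.
Qed.

Lemma continuous_pair (f : R * R -> R) : continuous f ->
  (forall x, continuous (fun y => f (x, y))) /\
  (forall y, continuous (fun x => f (x, y))).
Proof.
move=> cf; split=> [x y|y x].
  apply: (@continuous_comp _ _ _ (fun y => (x, y)) f); last exact: cf.
  by apply: (@cvg_pair _ _ _ _ (nbhs x) (nbhs y)); [exact: cvg_cst|exact: cvg_id].
apply: (@continuous_comp _ _ _ (fun x => (x, y)) f); last exact: cf.
by apply: (@cvg_pair _ _ _ _ (nbhs x) (nbhs y)); [exact: cvg_id|exact: cvg_cst].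
Qed.

Lemma continuous_swap (f : R * R -> R) : continuous f ->
  continuous (fun z => f (z.2, z.1)).
Proof.
move=> cf z; apply: (@continuous_comp _ _ _ (fun z : R * R => (z.2, z.1)) f).
  by apply: (@cvg_pair _ _ _ _ (nbhs z.2) (nbhs z.1)); [exact: cvg_snd|exact: cvg_fst].
exact: cf.
Qed.

Lemma continuous_integral (f : R * R -> R) c d : continuous f ->
  continuous (fun x => \int[mu]_(y in `[c, d]) f (x, y)).
Proof.
move=> cf x0; have [cf1 cf2] := continuous_pair cf.
(* A bound on a strip around [x0] is the constant dominating function. *)
have [M HM] := continuous_box_bounded (x0 - 1) (x0 + 1) c d cf.
apply: (@continuity_under_integral R _ mR mu (fun x y => f (x, y)) `[c, d] _
   (x0 - 1) (x0 + 1) _ _ (cst M)).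
- exact: measurable_itv.
- by move=> x _; exact: continuous_integrable.
- by apply: aeW => y _ x _; exact: cf2.
- by apply: continuous_integrable => y; exact: cvg_cst.
- move=> x; rewrite /= in_itv/= => /andP[/ltW x1 /ltW x2]; apply: aeW => y.
  by rewrite /= in_itv/=; apply: HM; rewrite x1.
- by rewrite inE/= in_itv/=; lra.
Qed.

Lemma integrable_box (f : R * R -> R) a b c d : continuous f ->
  (lebesgue2 R).-integrable setT
    ((EFin \o f) \_ (box a b c d) : mR * mR -> \bar R).
Proof.
move=> cf; apply/integrable_restrict => //; first exact: measurable_box.
rewrite setTI; apply: measurable_bounded_integrable.
- exact: measurable_box.
- have -> : lebesgue2 R (box a b c d) = (mu `[a, b]%classic * mu `[c, d]%classic)%E.
    by apply: product_measure1E; exact: measurable_itv.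
  by rewrite !lebesgue_measure_itv/=; do 2 case: ifP => _; rewrite ?mule0 ?mul0e ?ltry.
- by apply: measurable_funS (continuous_measurable_fun2 cf).
- have [M HM] := continuous_box_bounded a b c d cf.
  exists M; split=> [|N MN]; first exact: num_real.
  move=> [x y] [] /=; rewrite !in_itv/= => xab ycd.
  by rewrite (le_trans (HM _ _ xab ycd))// ltW.
Qed.

Lemma integral_box12 (f : R * R -> R) a b c d : continuous f ->
  (\int[lebesgue2 R]_(z in box a b c d) (f z)%:E =
   (\int[mu]_(x in `[a, b]) (\int[mu]_(y in `[c, d]) f (x, y))%R)%R%:E)%E.
Proof.
move=> cf; have [cf1 _] := continuous_pair cf.
rewrite integral_mkcond -(integral12_prod_meas1 (integrable_box a b c d cf)).
rewrite [in RHS]/Rintegral fineK; last first.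
  apply: integrable_fin_num => //; apply: continuous_integrable.
  exact: continuous_integral.
rewrite [RHS]integral_mkcond; apply: eq_integral => x _ /=.
rewrite /fubini_F [RHS]patchE; case: ifPn => xab.
  rewrite /Rintegral fineK; last first.
    by apply: integrable_fin_num => //; exact: continuous_integrable.
  rewrite [RHS]integral_mkcond; apply: eq_integral => y _.
  by rewrite !patchE /box in_setX xab.
rewrite -[RHS](integral0 mu setT); apply: eq_integral => y _.
by rewrite patchE /box in_setX (negbTE xab).
Qed.

Lemma integral_box21 (f : R * R -> R) a b c d : continuous f ->
  (\int[lebesgue2 R]_(z in box a b c d) (f z)%:E =
   (\int[mu]_(y in `[c, d]) (\int[mu]_(x in `[a, b]) f (x, y))%R)%R%:E)%E.
Proof.
move=> cf; have [_ cf2] := continuous_pair cf.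
rewrite integral_mkcond -(integral21_prod_meas1 (integrable_box a b c d cf)).
rewrite [in RHS]/Rintegral fineK; last first.
  apply: integrable_fin_num => //; apply: continuous_integrable.
  have cs := @continuous_integral _ a b (continuous_swap cf); exact: cs.
rewrite [RHS]integral_mkcond; apply: eq_integral => y _ /=.
rewrite /fubini_G [RHS]patchE; case: ifPn => ycd.
  rewrite /Rintegral fineK; last first.
    by apply: integrable_fin_num => //; exact: continuous_integrable.
  rewrite [RHS]integral_mkcond; apply: eq_integral => x _.
  by rewrite !patchE /box in_setX ycd andbT.
rewrite -[RHS](integral0 mu setT); apply: eq_integral => x _.
by rewrite patchE /box in_setX (negbTE ycd) andbF.
Qed.

Lemma Rintegral_swap (f : R * R -> R) a b c d : continuous f ->
  \int[mu]_(x in `[a, b]) (\int[mu]_(y in `[c, d]) f (x, y)) =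
  \int[mu]_(y in `[c, d]) (\int[mu]_(x in `[a, b]) f (x, y)).
Proof.
by move=> cf; apply: EFin_inj; rewrite -integral_box12// -integral_box21.
Qed.

End Plane.

(** * A potential on a box from zero flux through rectangles *)

Section Poincare.
Variable R : realType.
Notation mu := (@lebesgue_measure R).

Lemma continuous_fst_comp (f : R -> R) : continuous f ->
  continuous (fun z : R * R => f z.1).
Proof. by move=> cf z; apply: (@cvg_comp _ _ _ fst f); [exact: cvg_fst|exact: cf]. Qed.

Lemma continuous_snd_comp (f : R -> R) : continuous f ->
  continuous (fun z : R * R => f z.2).
Proof. by move=> cf z; apply: (@cvg_comp _ _ _ snd f); [exact: cvg_snd|exact: cf]. Qed.

Definition clamp (l r x : R) : R := Num.max l (Num.min r x).

Lemma clampP l r x : l <= r -> l <= clamp l r x <= r.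
Proof. by move=> lr; rewrite /clamp le_max ge_max ge_min !lexx lr. Qed.

Lemma clamp_id l r x : l <= x <= r -> clamp l r x = x.
Proof. by move=> /andP[lx xr]; rewrite /clamp min_r// max_r. Qed.

Lemma continuous_clamp l r : continuous (clamp l r).
Proof.
move=> x; apply: continuous_max; first exact: cvg_cst.
by apply: continuous_min; [exact: cvg_cst|exact: cvg_id].
Qed.

Lemma Cn_tensor k (a b : R -> R) : Cn k setT a -> Cn k setT b ->
  Cn k setT (fun z : R * R => a z.1 * b z.2).
Proof.
move=> Ca Cb; apply: CnM.
  apply: (@Cn_comp_affine R (R * R)%type k a fst fst) => //.
  by move=> z; exact: cvg_fst.
apply: (@Cn_comp_affine R (R * R)%type k b snd snd) => //.
by move=> z; exact: cvg_snd.
Qed.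

Lemma Cn1_is_derive (a : R -> R) x : Cn 1 setT a ->
  is_derive x (1 : R) a ('D_1 a x) /\ continuous ('D_1 a).
Proof.
case=> _ /(_ 1)[da [cda _]]; split; last by move=> y; exact: cda.
by split=> //; exact: da.
Qed.

Lemma test_function_tensor (Omega : set (R * R)) (l r m n : R) a b :
  box l r m n `<=` Omega -> test1 l r a -> test1 m n b ->
  test_function Omega (fun z => a z.1 * b z.2).
Proof.
move=> sO [Ca [l' [r' [ll' r'r a0]]]] [Cb [m' [n' [mm' n'n b0]]]].
have cl : closure [set z : R * R | a z.1 * b z.2 != 0] `<=` box l' r' m' n'.
  have cb : closed (box l' r' m' n').
    by apply: compact_closed; [exact: (@norm_hausdorff R (R * R)%type)|exact: compact_box].
  rewrite [X in _ `<=` X](closure_id _).1//.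
  apply: closureS => -[x y] /=; rewrite mulf_eq0 negb_or => /andP[ax by_].
  split; rewrite /= in_itv/=; apply: contrapT.
    by move=> H; rewrite a0// eqxx in ax.
  by move=> H; rewrite b0// eqxx in by_.
split.
- by move=> k; exact: Cn_tensor.
- by apply: subclosed_compact cl; [exact: closed_closure|exact: compact_box].
- apply: subset_trans cl _; apply: subset_trans sO => -[x y] [] /=.
  by rewrite !in_itv/= => ? ?; split; rewrite /= in_itv/=; lra.
Qed.

(** The field is continuous on Omega only. Clamping the arguments gives a function continuous on the
    whole plane with the same values on the box, as the integral lemmas require. *)
Definition extend (l r m n : R) (v : R * R -> R) (z : R * R) :=
  v (clamp l r z.1, clamp m n z.2).

Lemma continuous_extend l r m n v : l <= r -> m <= n ->
  (forall z, box l r m n z -> {for z, continuous v}) ->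
  continuous (extend l r m n v).
Proof.
move=> lr mn cv z.
apply: (@continuous_comp _ _ _ (fun z : R * R => (clamp l r z.1, clamp m n z.2)) v).
  apply: (@cvg_pair _ _ _ _ (nbhs (clamp l r z.1)) (nbhs (clamp m n z.2))).
    by apply: (@cvg_comp _ _ _ fst); [exact: cvg_fst|exact: continuous_clamp].
  by apply: (@cvg_comp _ _ _ snd); [exact: cvg_snd|exact: continuous_clamp].
by apply: cv; split; rewrite /= in_itv/=; exact: clampP.
Qed.

Section box.
Variables (Omega : set (R * R)) (v w : R * R -> R) (l r m n : R).
Hypotheses (lr : l < r) (mn : m < n) (sO : box l r m n `<=` Omega).
Hypothesis cv : forall z, Omega z -> {for z, continuous v}.
Hypothesis cw : forall z, Omega z -> {for z, continuous w}.
Hypothesis weak : forall phi, test_function Omega phi ->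
  (\int[lebesgue2 R]_(z in Omega)
     (v z * 'D_(e1 R) phi z + w z * 'D_(e2 R) phi z)%:E = 0)%E.

Let V := extend l r m n v.
Let W := extend l r m n w.

Let cV : continuous V.
Proof. by apply: continuous_extend; [exact: ltW|exact: ltW|move=> z /sO/cv]. Qed.

Let cW : continuous W.
Proof. by apply: continuous_extend; [exact: ltW|exact: ltW|move=> z /sO/cw]. Qed.

(** The test function vanishes outside a smaller box, so the integral over Omega is one over the
    box, where the field coincides with its extension. *)
Let weak_box a b : test1 l r a -> test1 m n b ->
  \int[mu]_(x in `[l, r]) (\int[mu]_(y in `[m, n])
     (V (x, y) * ('D_1 a x * b y) + W (x, y) * (a x * 'D_1 b y))) = 0.
Proof.
move=> ta tb; have tab := test_function_tensor sO ta tb.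
have [Ca [l' [r' [ll' r'r a0]]]] := ta.
have [Cb [m' [n' [mm' n'n b0]]]] := tb.
pose g z := V z * ('D_1 a z.1 * b z.2) + W z * (a z.1 * 'D_1 b z.2).
have ca x : {for x, continuous a} by case: (Ca 0) => H _; exact: H.
have cb x : {for x, continuous b} by case: (Cb 0) => H _; exact: H.
have da x := (Cn1_is_derive x (Ca 1)).1.
have db x := (Cn1_is_derive x (Cb 1)).1.
have cda := (Cn1_is_derive 0 (Ca 1)).2.
have cdb := (Cn1_is_derive 0 (Cb 1)).2.
have cg : continuous g.
  move=> z; apply: cvgD.
    apply: cvgM; first exact: cV.
    by apply: cvgM; [exact: (continuous_fst_comp cda)|exact: (continuous_snd_comp cb)].
  apply: cvgM; first exact: cW.
  by apply: cvgM; [exact: (continuous_fst_comp ca)|exact: (continuous_snd_comp cdb)].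
apply: EFin_inj; rewrite -(integral_box12 _ _ _ _ cg) -[RHS](weak tab).
rewrite [LHS]integral_mkcond [RHS]integral_mkcond; apply: eq_integral => -[x y] _.
rewrite !patchE.
have D1 : 'D_(e1 R) (fun z => a z.1 * b z.2) (x, y) = 'D_1 a x * b y.
  have H : is_derive x (1 : R) (fun x => a x * b y) ('D_1 a x * b y).
    apply: (is_derive_eq (is_deriveM (da x) (is_derive_cst (b y) x (1 : R)))).
    by rewrite /GRing.scale/= mulr0 add0r mulrC.
  by have [_ ->] := (is_derive_e1 (fun z => a z.1 * b z.2) (x, y) _).2 H.
have D2 : 'D_(e2 R) (fun z => a z.1 * b z.2) (x, y) = a x * 'D_1 b y.
  have H : is_derive y (1 : R) (fun y => a x * b y) (a x * 'D_1 b y).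
    apply: (is_derive_eq (is_deriveM (is_derive_cst (a x) y (1 : R)) (db y))).
    by rewrite /GRing.scale/= mulr0 addr0.
  by have [_ ->] := (is_derive_e2 (fun z => a z.1 * b z.2) (x, y) _).2 H.
case: ifPn => [|xyb].
  rewrite inE => -[/= xlr ymn]; rewrite ifT; last first.
    by rewrite inE; apply: sO; split.
  move: xlr ymn; rewrite !in_itv/= => xlr ymn.
  by rewrite D1 D2 /g /V /W /extend/= !clamp_id.
case: ifPn => // _; rewrite D1 D2; congr EFin.
(* The complement of [l1, r1] is open, so the derivative vanishes there too: outside the box one of
   [a], [b] is zero together with its derivative. *)
have near0 (f : R -> R) (l1 r1 x1 : R) : (forall x, ~ l1 <= x <= r1 -> f x = 0) ->
    ~ l1 <= x1 <= r1 -> 'D_1 f x1 = 0.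
  move=> f0 /negP; rewrite negb_and -!ltNge => x1N.
  have N : {near x1, (fun _ => 0) =1 f}.
    case/orP: x1N => x1N; near=> t; rewrite f0//; apply/negP;
      rewrite negb_and -!ltNge; apply/orP; [left|right]; near: t.
      exact: lt_nbhsl.
    exact: lt_nbhsr.
  by have [_ ->] := near_eq_is_derive N (is_derive_cst (0 : R) x1 (1 : R)).
have [xl|xl] := boolP (l' <= x <= r').
  have ymn : ~ m' <= y <= n'.
    move=> ymn; move/negP: xyb; apply; rewrite inE.
    by move: xl ymn ll' r'r mm' n'n; clear; split; rewrite /= in_itv/=; lra.
  by rewrite b0// (near0 b m' n')// !mulr0 addr0.
by rewrite a0 ?(near0 a l' r')// ?mul0r ?mulr0 ?addr0//; exact/negP.
Unshelve. all: by end_near. Qed.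

Let PV x := primitive (fun y => V (x, y)).
Let PW y := primitive (fun x => W (x, y)).

Let dPV x y : is_derive y (1 : R) (PV x) (V (x, y)).
Proof. by apply: is_derive_primitive; have [H _] := continuous_pair cV; exact: H. Qed.

Let dPW x y : is_derive x (1 : R) (PW y) (W (x, y)).
Proof. by apply: is_derive_primitive; have [_ H] := continuous_pair cW; exact: H. Qed.

(** The integrated form of V_x + W_y = 0. The du Bois-Reymond lemma is applied in x for a fixed test
    function [b] of y and then, after exchanging the integrals, in y. *)
Let flux_le x1 x2 y1 y2 : l < x1 -> x1 <= x2 -> x2 < r ->
  m < y1 -> y1 <= y2 -> y2 < n ->
  (PW y2 x2 - PW y2 x1) - (PW y1 x2 - PW y1 x1) =
  - ((PV x2 y2 - PV x1 y2) - (PV x2 y1 - PV x1 y1)).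
Proof.
move=> lx1 x12 x2r my1 y12 y2n.
have [cV1 cV2] := continuous_pair cV; have [cW1 cW2] := continuous_pair cW.
pose D y := \int[mu]_(x in `[x1, x2]) W (x, y).
have DE y : D y = PW y x2 - PW y x1.
  by rewrite /D (integral_is_derive x12 (cW2 y) (fun x _ => dPW x y)).
have cD : continuous D.
  have H := @continuous_integral R _ x1 x2 (continuous_swap cW); exact: H.
pose E y := - (V (x2, y) - V (x1, y)).
have cE : continuous E.
  by move=> y; apply: cvgN; apply: cvgB; exact: cV1.
have IE : \int[mu]_(y in `[y1, y2]) E y =
    - (PV x2 y2 - PV x1 y2) - - (PV x2 y1 - PV x1 y1).
  have dE y : is_derive y (1 : R) (fun y => - (PV x2 y - PV x1 y)) (E y).
    by apply: is_deriveN; exact: is_deriveB.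
  by rewrite (integral_is_derive y12 cE (fun y _ => dE y)).
suff : D y2 - D y1 = \int[mu]_(y in `[y1, y2]) E y.
  by rewrite !DE IE => ->; ring.
apply: (@du_bois_reymond R m n) => // b tb.
have [Cb _] := tb.
have cb : continuous b by move=> y; case: (Cb 0) => H _; exact: H.
have cdb := (Cn1_is_derive 0 (Cb 1)).2.
have cVb : continuous (fun z => V z * b z.2).
  move=> z; apply: cvgM; first exact: cV.
  exact: (continuous_snd_comp cb).
have cWb : continuous (fun z => W z * 'D_1 b z.2).
  move=> z; apply: cvgM; first exact: cW.
  exact: (continuous_snd_comp cdb).
pose A x := \int[mu]_(y in `[m, n]) (V (x, y) * b y).
pose B x := \int[mu]_(y in `[m, n]) (W (x, y) * 'D_1 b y).
have cA : continuous A by have H := @continuous_integral R _ m n cVb; exact: H.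
have cB : continuous B by have H := @continuous_integral R _ m n cWb; exact: H.
have cVbx x : continuous (fun y => V (x, y) * b y).
  by have [H _] := continuous_pair cVb; exact: H.
have cWbx x : continuous (fun y => W (x, y) * 'D_1 b y).
  by have [H _] := continuous_pair cWb; exact: H.
have : A x2 - A x1 = \int[mu]_(x in `[x1, x2]) B x.
  apply: (@du_bois_reymond R l r) => // a ta.
  rewrite -[RHS](weak_box ta tb); apply: eq_Rintegral => x _.
  rewrite /A /B -RintegralZr//; last exact: continuous_integrable.
  rewrite -RintegralZr//; last exact: continuous_integrable.
  rewrite -RintegralD//; last 2 first.
  - apply: continuous_integrable => y; apply: cvgM; [exact: cVbx|exact: cvg_cst].
  - apply: continuous_integrable => y; apply: cvgM; [exact: cWbx|exact: cvg_cst].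
  by apply: eq_Rintegral => y _; ring.
rewrite (Rintegral_swap x1 x2 m n cWb) /= => AB.
have -> : \int[mu]_(t in `[m, n]) (D t * 'D_1 b t + E t * b t) =
   \int[mu]_(t in `[m, n]) (D t * 'D_1 b t) -
   (\int[mu]_(t in `[m, n]) (V (x2, t) * b t) - \int[mu]_(t in `[m, n]) (V (x1, t) * b t)).
  rewrite -RintegralB//; [|exact: continuous_integrable..].
  rewrite -RintegralB//; last 2 first.
  - by apply: continuous_integrable => y; apply: cvgM; [exact: cD|exact: cdb].
  - by apply: continuous_integrable => y; apply: cvgB; exact: cVbx.
  by apply: eq_Rintegral => y _; rewrite /E; ring.
rewrite -/(A x2) -/(A x1) AB; apply/eqP; rewrite subr_eq0; apply/eqP.
apply: eq_Rintegral => y _; rewrite /D -RintegralZr//.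
exact: continuous_integrable.
Qed.

Let flux x1 x2 y1 y2 : l < x1 < r -> l < x2 < r -> m < y1 < n -> m < y2 < n ->
  (PW y2 x2 - PW y2 x1) - (PW y1 x2 - PW y1 x1) =
  - ((PV x2 y2 - PV x1 y2) - (PV x2 y1 - PV x1 y1)).
Proof.
move=> /andP[? ?] /andP[? ?] /andP[? ?] /andP[? ?].
have [x12|/ltW x12] := leP x1 x2; have [y12|/ltW y12] := leP y1 y2.
- exact: flux_le.
- by have := @flux_le x1 x2 y2 y1; lra.
- by have := @flux_le x2 x1 y1 y2; lra.
- by have := @flux_le x2 x1 y2 y1; lra.
Qed.

Lemma box_potential : exists psi : R * R -> R, forall x y, l < x < r -> m < y < n ->
  is_derive (x, y) (e1 R) psi (w (x, y)) /\ is_derive (x, y) (e2 R) psi (- v (x, y)).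
Proof.
pose y0 := (m + n) / 2.
(* The field (w, - v) is integrated horizontally at height [y0], then vertically; the y-derivative
   is immediate. *)
exists (fun z => PW y0 z.1 - (PV z.1 z.2 - PV z.1 y0)) => x y xlr ymn.
have VE : V (x, y) = v (x, y).
  by rewrite /V /extend/= !clamp_id//; lra.
have WE : W (x, y) = w (x, y).
  by rewrite /W /extend/= !clamp_id//; lra.
have y0mn : m < y0 < n by rewrite /y0; lra.
split.
  apply/is_derive_e1 => /=; rewrite -WE.
  (* By [flux] the horizontal leg can be moved to height [y] at the cost of a constant, which gives
     the x-derivative. *)
  pose c := PW y0 x - (PV x y - PV x y0) - PW y x.
  have N : {near x, (fun t => PW y t + c) =1
                    (fun t => PW y0 t - (PV t y - PV t y0))}.
    near=> t.
    have tlr : l < t < r.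
      by apply/andP; split; near: t; [apply: lt_nbhsr|apply: lt_nbhsl]; lra.
    by have := flux xlr tlr y0mn ymn; rewrite /c; lra.
  apply: near_eq_is_derive N _; rewrite -[W _]addr0.
  by apply: is_deriveD; exact: dPW.
apply/is_derive_e2 => /=; rewrite -VE -[- V _]add0r.
apply: is_deriveB; rewrite -[V _]subr0.
exact: is_deriveB.
Unshelve. all: by end_near. Qed.

End box.

End Poincare.

(** * The eikonal equation in the plane *)

Section PlaneCalculus.
Variable R : realType.
Implicit Types (z w v : R * R) (A : set (R * R)) (psi : R * R -> R)
  (g : R * R -> R * R).

Definition C1_on A psi g : Prop := forall z, A z ->
  [/\ is_derive z (e1 R) psi (g z).1, is_derive z (e2 R) psi (g z).2 &
      {for z, continuous g}].

Lemma ballE2 z e w : ball z e w <-> `|w.1 - z.1| < e /\ `|w.2 - z.2| < e.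
Proof. by split=> -[]; rewrite /ball/= => H1 H2; split; rewrite /ball/= distrC. Qed.

Lemma MVT_between (f df : R -> R) (a b : R) :
  (forall x, `|x - a| <= `|b - a| -> is_derive x (1 : R) f (df x)) ->
  exists2 c, `|c - a| <= `|b - a| & f b - f a = df c * (b - a).
Proof.
move=> fdf; have [ab|/ltW ba] := leP a b.
  have H x : a <= x <= b -> is_derive x (1 : R) f (df x).
    by move=> /andP[ax xb]; apply: fdf; rewrite !ger0_norm ?subr_ge0//; lra.
  have [c /andP[ac cb] E] := MVT_is_derive ab H.
  by exists c => //; rewrite !ger0_norm ?subr_ge0//; lra.
have H x : b <= x <= a -> is_derive x (1 : R) f (df x).
  by move=> /andP[ax xb]; apply: fdf; rewrite !ler0_norm ?subr_le0//; lra.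
have [c /andP[ac cb] E] := MVT_is_derive ba H.
exists c; first by rewrite !ler0_norm ?subr_le0//; lra.
by rewrite -opprB E; ring.
Qed.

(** A substitute for the total derivative: [S] consists of the difference quotients along a
    horizontal and then a vertical segment. By the mean value theorem they are components of [g] at
    intermediate points, hence tend to [g z]. *)
Lemma C1_slope A psi g z : open A -> C1_on A psi g -> A z ->
  exists S : R * R -> R * R, [/\ {for z, continuous S}, S z = g z &
    forall w, psi w - psi z = dot (S w) (w - z)].
Proof.
move=> oA C Az; have [_ _ cg] := C z Az.
pose S1 w := if w.1 == z.1 then (g z).1
  else (psi (w.1, z.2) - psi (z.1, z.2)) / (w.1 - z.1).
pose S2 w := if w.2 == z.2 then (g (w.1, z.2)).2
  else (psi (w.1, w.2) - psi (w.1, z.2)) / (w.2 - z.2).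
have Sz : (S1 z, S2 z) = g z.
  by rewrite /S1 /S2 !eqxx -!surjective_pairing.
exists (fun w => (S1 w, S2 w)); split => //.
- apply/cvg_ballP => e e0; rewrite Sz.
  suff : \forall w \near z, ball (g z) e (S1 w, S2 w) by [].
  have /nbhs_ballP[d1 /= d10 D1] : \forall w \near z, ball (g z) e (g w).
    by apply: cg; exact: nbhsx_ballx.
  have /nbhs_ballP[d2 /= d20 D2] := open_nbhs_nbhs (conj oA Az).
  apply/nbhs_ballP; exists (Num.min d1 d2); first by rewrite /= lt_min d10.
  move=> w /ballE2[]; rewrite !lt_min => /andP[w11 w12] /andP[w21 w22].
  have near_w zeta : `|zeta.1 - z.1| <= `|w.1 - z.1| ->
      `|zeta.2 - z.2| <= `|w.2 - z.2| -> A zeta /\ ball (g z) e (g zeta).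
    move=> z1 z2; split; [apply: D2|apply: D1]; apply/ballE2; split;
      by [exact: le_lt_trans z1 _|exact: le_lt_trans z2 _].
  apply/ballE2 => /=; split.
    rewrite /S1; case: ifPn => [_|w1]; first by rewrite subrr normr0.
    have dS x : `|x - z.1| <= `|w.1 - z.1| ->
        is_derive x (1 : R) (fun x => psi (x, z.2)) (g (x, z.2)).1.
      move=> xw; have [|Ax _] := near_w (x, z.2) xw; first by rewrite /= subrr normr0.
      by have [/is_derive_e1] := C _ Ax.
    have [c cw ->] := MVT_between dS.
    rewrite mulfK ?subr_eq0//.
    have [|_ /ballE2[]//] := near_w (c, z.2) cw.
    by rewrite /= subrr normr0.
  rewrite /S2; case: ifPn => [_|w2].
    have [||_ /ballE2[]//] := near_w (w.1, z.2); first by [].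
    by rewrite /= subrr normr0.
  have dS y : `|y - z.2| <= `|w.2 - z.2| ->
      is_derive y (1 : R) (fun y => psi (w.1, y)) (g (w.1, y)).2.
    move=> yw; have [//|//|Ax _] := near_w (w.1, y).
    by have [_ /is_derive_e2] := C _ Ax.
  have [c cw ->] := MVT_between dS.
  rewrite mulfK ?subr_eq0//.
  by have [//|//|_ /ballE2[]//] := near_w (w.1, c).
- move=> w; rewrite /dot /S1 /S2 /=.
  have [w1|w1] := eqVneq w.1 z.1; have [w2|w2] := eqVneq w.2 z.2.
  + by rewrite w1 w2 !subrr !mulr0 addr0 (surjective_pairing w) w1 w2 -surjective_pairing subrr.
  + rewrite w1 subrr mulr0 add0r divfK ?subr_eq0//.
    by rewrite (surjective_pairing w) w1 -surjective_pairing.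
  + rewrite w2 subrr mulr0 addr0 divfK ?subr_eq0//.
    by rewrite (surjective_pairing w) w2 -surjective_pairing.
  + rewrite !divfK ?subr_eq0//  -!surjective_pairing; ring.
Qed.

End PlaneCalculus.

Section Curves.
Variable R : realType.
Implicit Types (z w v : R * R) (A : set (R * R)) (psi : R * R -> R)
  (g : R * R -> R * R) (c : R -> R * R).

Lemma is_derive_curve c s d : is_derive s (1 : R) c d <->
  is_derive s (1 : R) (fun t => (c t).1) d.1 /\
  is_derive s (1 : R) (fun t => (c t).2) d.2.
Proof.
split=> [/is_deriveP H|[/is_deriveP H1 /is_deriveP H2]].
  split; apply/is_deriveP.
    have H1 : fst @ d --> d.1 by exact: cvg_fst.
    exact: (cvg_comp _ _ H H1).
  have H2 : snd @ d --> d.2 by exact: cvg_snd.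
  exact: (cvg_comp _ _ H H2).
apply/is_deriveP; case: d H1 H2 => d1 d2 /= H1 H2.
exact: (cvg_pair H1 H2).
Qed.

Lemma is_derive_affine z v t : is_derive t (1 : R) (fun t => z + t *: v) v.
Proof.
apply/is_deriveP.
have -> : (fun h : R => h^-1 *: (((fun t => z + t *: v) \o shift t) (h *: (1 : R)) -
    (z + t *: v))) = (fun h => (h^-1 * h) *: v).
  apply/funext => h /=; rewrite opprD addrACA subrr add0r -scalerBl -addrA subrr addr0.
  by rewrite scalerA /GRing.scale/= mulr1.
apply: cvg_near_cst; near=> h; rewrite mulVf ?scale1r//.
by near: h; exact: nbhs_dnbhs_neq.
Unshelve. all: by end_near. Qed.

Lemma cvg_dot (T : Type) (F : set_system T) (FF : Filter F) (f h : T -> R * R) a b :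
  f @ F --> a -> h @ F --> b -> (fun x => dot (f x) (h x)) @ F --> dot a b.
Proof.
have c1 z : fst @ z --> z.1 by exact: cvg_fst.
have c2 z : snd @ z --> z.2 by exact: cvg_snd.
move=> fa hb; apply: cvgD; apply: cvgM.
- exact: (cvg_comp _ _ fa (c1 _)).
- exact: (cvg_comp _ _ hb (c1 _)).
- exact: (cvg_comp _ _ fa (c2 _)).
- exact: (cvg_comp _ _ hb (c2 _)).
Qed.

Lemma C1_chain A psi g c s d : open A -> C1_on A psi g -> A (c s) ->
  is_derive s (1 : R) c d ->
  is_derive s (1 : R) (psi \o c) (dot (g (c s)) d).
Proof.
move=> oA C Acs dc; have [S [cS Ss SE]] := C1_slope oA C Acs.
have cc := is_derive_continuous dc.
apply/is_deriveP; rewrite -Ss.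
have -> : (fun h : R => h^-1 *: (((psi \o c) \o shift s) (h *: (1 : R)) - (psi \o c) s)) =
    (fun h : R => dot (S (c (h + s))) (h^-1 *: ((c \o shift s) (h *: (1 : R)) - c s))).
  apply/funext => h /=; rewrite SE /dot /= /GRing.scale /= mulr1; ring.
apply: cvg_dot; last exact/is_deriveP.
have : (fun h => S (c (h + s))) @ (0 : R) --> S (c (0 + s)).
  apply: (@continuous_comp _ _ _ (fun h : R => c (h + s)) S); last by rewrite add0r.
  apply: (@continuous_comp _ _ _ (fun h : R => h + s) c); last by rewrite add0r.
  by apply: cvgD; [exact: cvg_id|exact: cvg_cst].
by rewrite add0r => H; apply: cvg_within_filter H.
Qed.

(** The Euclidean norm; the norm of [R * R] is the maximum norm, whose [ball] is a square. *)
Definition norm2 v : R := Num.sqrt (dot v v).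

Lemma dotC v w : dot v w = dot w v.
Proof. by rewrite /dot; ring. Qed.

Lemma dot_ge0 v : 0 <= dot v v.
Proof. by rewrite /dot -!expr2 addr_ge0 ?sqr_ge0. Qed.

Lemma norm2_ge0 v : 0 <= norm2 v. Proof. exact: sqrtr_ge0. Qed.

Lemma norm2_sqr v : norm2 v ^+ 2 = dot v v.
Proof. by rewrite sqr_sqrtr// dot_ge0. Qed.

Lemma dot_le v w : dot v w <= norm2 v * norm2 w.
Proof.
rewrite /norm2 -sqrtrM ?dot_ge0//.
rewrite (le_trans (ler_norm _))// -sqrtr_sqr ler_sqrt; last first.
  by rewrite mulr_ge0 ?dot_ge0.
rewrite -subr_ge0 /dot; set e := (X in 0 <= X).
have -> : e = (v.1 * w.2 - v.2 * w.1) ^+ 2 by rewrite /e; ring.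
exact: sqr_ge0.
Qed.

Lemma dot_unit_le v w : dot v v = 1 -> dot v w <= norm2 w.
Proof. by move=> v1; rewrite (le_trans (dot_le v w))// /norm2 v1 sqrtr1 mul1r. Qed.

Lemma norm2D v w : norm2 (v + w) <= norm2 v + norm2 w.
Proof.
rewrite -(@ler_pXn2r _ 2)// ?nnegrE ?addr_ge0 ?norm2_ge0// norm2_sqr.
have -> : dot (v + w) (v + w) = dot v v + dot w w + 2 * dot v w.
  by rewrite /dot /=; ring.
rewrite -!norm2_sqr; have := dot_le v w; lra.
Qed.

Lemma norm2Z t v : norm2 (t *: v) = `|t| * norm2 v.
Proof.
rewrite /norm2; have -> : dot (t *: v) (t *: v) = t ^+ 2 * dot v v.
  by rewrite /dot /= /GRing.scale /=; ring.
by rewrite sqrtrM ?sqr_ge0// sqrtr_sqr.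
Qed.

Lemma norm2_ge1 v : `|v.1| <= norm2 v.
Proof.
rewrite -sqrtr_sqr ler_sqrt ?dot_ge0// /dot -expr2.
by rewrite lerDl -expr2 sqr_ge0.
Qed.

Lemma norm2_ge2 v : `|v.2| <= norm2 v.
Proof.
rewrite -sqrtr_sqr ler_sqrt ?dot_ge0// /dot -!expr2.
by rewrite lerDr sqr_ge0.
Qed.

Lemma norm2_le v : norm2 v <= `|v.1| + `|v.2|.
Proof.
rewrite -(@ler_pXn2r _ 2)// ?nnegrE ?addr_ge0 ?norm2_ge0// norm2_sqr.
rewrite sqrrD !real_normK ?num_real// /dot -!expr2.
by rewrite addrAC lerDl mulrn_wge0// mulr_ge0.
Qed.

Lemma continuous_norm2B z : continuous (fun w => norm2 (w - z)).
Proof.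
move=> w; apply: (@continuous_comp _ _ _ (fun w => dot (w - z) (w - z)) Num.sqrt).
  by apply: cvg_dot; apply: cvgB; [exact: cvg_id|exact: cvg_cst|exact: cvg_id|exact: cvg_cst].
exact: sqrt_continuous.
Qed.

Lemma unit_eq v w : dot v v = 1 -> dot w w = 1 -> dot v w = 1 -> v = w.
Proof.
move=> v1 w1 vw.
have H : (v.1 - w.1) ^+ 2 + (v.2 - w.2) ^+ 2 = 0.
  have -> : (v.1 - w.1) ^+ 2 + (v.2 - w.2) ^+ 2 = dot v v + dot w w - 2 * dot v w.
    by rewrite /dot; ring.
  by rewrite v1 w1 vw; ring.
move/eqP: H; rewrite paddr_eq0 ?sqr_ge0// !sqrf_eq0 !subr_eq0.
by move=> /andP[/eqP H1 /eqP H2]; apply: injective_projections.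
Qed.

Lemma unit_norm1 v : dot v v = 1 -> `|v.1| <= 1 /\ `|v.2| <= 1.
Proof.
move=> v1; have := norm2_ge1 v; have := norm2_ge2 v.
by rewrite /norm2 v1 sqrtr1.
Qed.

Lemma ball_convex z r w w' t : ball z r w -> ball z r w' -> 0 <= t <= 1 ->
  ball z r (w + t *: (w' - w)).
Proof.
move=> /ballE2[a1 a2] /ballE2[b1 b2] /andP[t0 t1].
have H (x y u : R) : `|x - u| < r -> `|y - u| < r -> `|x + t * (y - x) - u| < r.
  move=> xu yu.
  have -> : x + t * (y - x) - u = (1 - t) * (x - u) + t * (y - u) by ring.
  rewrite (le_lt_trans (ler_normD _ _))// !normrM (ger0_norm t0) ger0_norm; last lra.
  have [->|tn0] := eqVneq t 0; first by rewrite mul0r addr0 subr0 mul1r.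
  have tp : 0 < t by lra.
  have : t * `|y - u| < t * r by rewrite ltr_pM2l.
  have : (1 - t) * `|x - u| <= (1 - t) * r by apply: ler_wpM2l; [lra|exact: ltW].
  lra.
by apply/ballE2; split; exact: H.
Qed.

Lemma open_ball z (r : R) : open (ball z r).
Proof. exact: (@ball_open R (R * R)%type). Qed.

End Curves.

Lemma C1_continuous (R : realType) (A : set (R * R)) (psi : R * R -> R) g z :
  open A -> C1_on A psi g -> A z -> {for z, continuous psi}.
Proof.
move=> oA C Az; have [S [cS _ SE]] := C1_slope oA C Az.
have -> : psi = fun w => psi z + dot (S w) (w - z).
  by apply/funext => w; rewrite -SE addrC subrK.
have H : (fun w => psi z + dot (S w) (w - z)) @ z --> psi z + dot (S z) (z - z).
  apply: cvgD; first exact: cvg_cst.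
  by apply: cvg_dot => //; apply: cvgB; [exact: cvg_id|exact: cvg_cst].
exact: H.
Qed.

Section Eikonal.
Variable R : realType.
Implicit Types (z w v : R * R) (A : set (R * R)) (psi : R * R -> R)
  (g : R * R -> R * R) (c : R -> R * R).

Definition eikonal z0 (r : R) psi g : Prop :=
  C1_on (ball z0 r) psi g /\ forall z, ball z0 r z -> dot (g z) (g z) = 1.

Lemma eikonalN z0 r psi g :
  eikonal z0 r psi g -> eikonal z0 r (fun z => - psi z) (fun z => - g z).
Proof.
move=> [C g1]; split=> z zr.
  have [d1 d2 cg] := C z zr; split.
  - by have := is_deriveN d1.
  - by have := is_deriveN d2.
  - exact: cvgN.
by rewrite -[RHS](g1 z zr) /dot /=; ring.
Qed.

Lemma eikonal_affine z0 r psi g z v t : eikonal z0 r psi g ->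
  ball z0 r (z + t *: v) ->
  is_derive t (1 : R) (fun t => psi (z + t *: v)) (dot (g (z + t *: v)) v).
Proof.
move=> [C _] zt.
exact: (C1_chain (c := fun t => z + t *: v) (@open_ball _ z0 r) C zt (is_derive_affine z v t)).
Qed.

Lemma eikonal_lipschitz z0 r psi g z w : eikonal z0 r psi g ->
  ball z0 r z -> ball z0 r w -> psi w - psi z <= norm2 (w - z).
Proof.
move=> E zr wr; have [C g1] := E.
have inb t : 0 <= t <= 1 -> ball z0 r (z + t *: (w - z)) by exact: ball_convex.
have d t (t01 : 0 <= t <= 1) := eikonal_affine E (inb t t01).
have [t t01] := MVT_is_derive (@ler01 R) d.
rewrite scale1r scale0r addr0 subr0 mulr1 [z + (w - z)]addrC subrK => ->.
by apply: dot_unit_le; apply: g1; exact: inb.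
Qed.

(* A curve along the gradient gains potential at the maximal rate, so comparing it
   with its translate by [t *: v] shows that [t = 0] maximises the gain of potential
   along the translated curve. *)
Lemma eikonal_gradient_curve z0 r psi g c a b : eikonal z0 r psi g -> a <= b ->
  (forall s, a <= s <= b -> ball z0 (r / 2) (c s)) ->
  (forall s, a <= s <= b -> is_derive s (1 : R) c (g (c s))) ->
  g (c a) = g (c b).
Proof.
move=> E ab cr dc; have [C g1] := E.
have r0 : 0 < r.
  by have := cr a; rewrite lexx ab => /(_ isT)/ballE2[]; have := normr_ge0 ((c a).1 - z0.1); lra.
(* Halving the radius leaves room for translating the curve by any [t] below [r / 2]. *)
have inb s t v : a <= s <= b -> `|v.1| <= 1 -> `|v.2| <= 1 ->
    `|t| < r / 2 -> ball z0 r (c s + t *: v).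
  move=> /cr/ballE2[c1 c2] v1 v2 tr.
  have H (x y u : R) : `|x - y| < r / 2 -> `|u| <= 1 -> `|x + t * u - y| < r.
    move=> xy u1; rewrite addrAC (le_lt_trans (ler_normD _ _))// normrM.
    have : `|t| * `|u| <= `|t| * 1 by apply: ler_wpM2l.
    lra.
  by apply/ballE2; split; exact: H.
have cN s : a <= s <= b -> ball z0 r (c s).
  move=> sab; have := inb s 0 0 sab; rewrite scale0r addr0; apply; rewrite ?normr0 ?ler01//; lra.
have gain0 : psi (c b) - psi (c a) = b - a.
  have d s (sab : a <= s <= b) := C1_chain (@open_ball _ z0 r) C (cN s sab) (dc s sab).
  have [s sab] := MVT_is_derive ab d.
  by rewrite /= => ->; rewrite g1 ?mul1r//; exact: cN.
have key v : `|v.1| <= 1 -> `|v.2| <= 1 -> dot (g (c b)) v = dot (g (c a)) v.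
  move=> v1 v2.
  pose f t := psi (c b + t *: v) - psi (c a + t *: v).
  have aab : a <= a <= b by rewrite lexx.
  have bab : a <= b <= b by rewrite lexx ab.
  have inr t : t \in `](- (r / 2)), (r / 2)[%R -> `|t| < r / 2.
    by rewrite in_itv/= ltr_norml.
  have df t : `|t| < r / 2 ->
      is_derive t (1 : R) f (dot (g (c b + t *: v)) v - dot (g (c a + t *: v)) v).
    by move=> tr; apply: is_deriveB; apply: (eikonal_affine E); exact: inb.
  have fmax t : t \in `](- (r / 2)), (r / 2)[%R -> f t <= f 0.
    move=> /inr tr.
    have dct s : a <= s <= b -> is_derive s (1 : R) (fun s => c s + t *: v) (g (c s)).
      move=> sab; rewrite -[X in is_derive _ _ _ X]addr0.
      by apply: is_deriveD; exact: dc.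
    have d s (sab : a <= s <= b) :=
      C1_chain (c := fun s => c s + t *: v) (@open_ball _ z0 r) C
        (inb s t v sab v1 v2 tr) (dct s sab).
    have [s sab] := MVT_is_derive ab d.
    rewrite /f /= => ->; rewrite !scale0r !addr0 gain0.
    rewrite -[leRHS]mul1r; apply: ler_wpM2r; first by rewrite subr_ge0.
    apply: le_trans (dot_unit_le _ _) _; first by apply: g1; exact: inb.
    by rewrite /norm2 g1 ?sqrtr1//; exact: cN.
  have r20 : `|0 : R| < r / 2 by rewrite normr0; lra.
  have in0 : (0 : R) \in `](- (r / 2)), (r / 2)[%R by rewrite in_itv/=; lra.
  have rr : - (r / 2) <= r / 2 by lra.
  have dft t : t \in `](- (r / 2)), (r / 2)[%R -> derivable f t 1.
    by move=> /inr/df[].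
  have [_ f0] := derive1_at_max rr dft in0 fmax.
  have [_] := df 0 r20; rewrite f0 !scale0r !addr0 => /esym/eqP.
  by rewrite subr_eq0 => /eqP.
have k1 := key (1, 0); have k2 := key (0, 1).
move: k1 k2; rewrite /dot /= !normr0 !normr1 !mulr1 !mulr0 !addr0 !add0r.
move=> k1 k2; apply: injective_projections; apply/esym.
  by rewrite k1.
by rewrite k2.
Qed.

(** One side suffices; this is used at the initial point of a segment, before which nothing is known
    about [f]. *)
Lemma is_derive_zero_right (f : R -> R) x y k : is_derive x (1 : R) f k ->
  x < y -> (forall t, x <= t < y -> f t = 0) -> k = 0.
Proof.
move=> /is_derive1_caratheodory[G [fE cG Gx]] xy f0; apply/eqP/negP => /negP k0.
have N : \forall t \near x, G t != 0.
  have : \forall t \near x, `|G t - k| < `|k|.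
    have cGk : G @ x --> k by rewrite -Gx; exact: cG.
    move/cvgr_distC_lt: cGk; apply.
    by rewrite normr_gt0.
  apply: filterS => t; apply: contraTneq => ->.
  by rewrite sub0r normrN ltxx.
have [t [xt ty Gt]] : exists t, [/\ x < t, t < y & G t != 0].
  near x^'+ => t; exists t; split; near: t.
  - exact: nbhs_right_gt.
  - exact: nbhs_right_lt.
  - exact: cvg_at_right_filter N.
have := fE t; rewrite !f0 ?lexx ?xy ?(ltW xt) ?ty// subrr => /esym/eqP.
by rewrite mulf_eq0 (negbTE Gt)/= subr_eq0 gt_eqF.
Unshelve. all: by end_near. Qed.

Section line.
Variables (z0 z : R * R) (r rho : R) (psi : R * R -> R) (g : R * R -> R * R).
Hypotheses (E : eikonal z0 r psi g) (rho0 : 0 < rho).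
Hypothesis zr : forall w, `|w.1 - z.1| <= rho -> `|w.2 - z.2| <= rho -> ball z0 r w.

Let K := box (z.1 - rho) (z.1 + rho) (z.2 - rho) (z.2 + rho).

Let KP w : K w <-> `|w.1 - z.1| <= rho /\ `|w.2 - z.2| <= rho.
Proof.
by rewrite /K /box/= /setX/= !in_itv/= !ler_distl.
Qed.

Let cN (k : R) w : ball z0 r w -> {for w, continuous (fun w => psi w - k * norm2 (w - z))}.
Proof.
move=> wr; have [C _] := E.
apply: cvgB; first exact: (C1_continuous (@open_ball _ z0 r) C wr).
apply: cvgM; first exact: cvg_cst.
exact: continuous_norm2B.
Qed.

(* moving along the gradient increases [psi - (1 - e) * norm2 (_ - z)], hence the
   maximum over the box lies on its boundary *)
Let boundary_max e : 0 < e < 1 -> exists w, [/\ K w, rho <= norm2 (w - z) &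
  psi z <= psi w - (1 - e) * norm2 (w - z)].
Proof.
move=> /andP[e0 e1].
have K0 : K !=set0 by exists z; apply/KP; rewrite !subrr normr0 ltW.
have cK : {within K, continuous (fun w => psi w - (1 - e) * norm2 (w - z))}.
  by apply: continuous_in_subspaceT => w; rewrite inE => /KP[w1 w2]; apply: cN; exact: zr.
have [w] := compact_EVT_max K0 (@compact_box _ _ _ _ _) cK.
rewrite inE => /[dup] Kw /KP[w1 w2] wmax.
have wr := zr w1 w2.
have zK : z \in K by rewrite inE; apply/KP; rewrite !subrr normr0 ltW.
exists w; split=> //; last first.
  by have := wmax z zK; rewrite subrr /norm2 /dot/= mulr0 addr0 sqrtr0 mulr0 subr0.
rewrite leNgt; apply/negP => wrho.
have w1' : `|w.1 - z.1| < rho by apply: le_lt_trans wrho; exact: (norm2_ge1 (w - z)).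
have w2' : `|w.2 - z.2| < rho by apply: le_lt_trans wrho; exact: (norm2_ge2 (w - z)).
have [C g1] := E.
pose f t := psi (w + t *: g w) - psi w - (1 - e) * t.
have df : is_derive (0 : R) (1 : R) f e.
  have wr0 : ball z0 r (w + 0 *: g w) by rewrite scale0r addr0.
  have d := eikonal_affine E wr0; rewrite scale0r addr0 g1// in d.
  have d' : is_derive (0 : R) (1 : R) (fun t : R => (1 - e) * t) (1 - e).
    by have := is_deriveZ (1 - e) (is_derive_id (0 : R) (1 : R)); rewrite /GRing.scale/= mulr1.
  have := is_deriveB (is_deriveB d (is_derive_cst (psi w) (0 : R) (1 : R))) d'.
  by rewrite subr0 opprB addrCA subrr addr0.
have [gw1 gw2] := unit_norm1 (g1 w wr).
have [t [t0 ft Kt]] : exists t, [/\ 0 < t, 0 < f t & K (w + t *: g w)].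
  have /is_derive1_caratheodory[G [fE cG G0]] := df.
  have N : \forall t \near (0 : R), 0 < G t.
    have cGe : G @ (0 : R) --> e by rewrite -G0; exact: cG.
    by move/cvgr_gt: cGe; apply.
  near (0 : R)^'+ => t; exists t.
  have t0 : 0 < t by near: t; exact: nbhs_right_gt.
  have Gt : 0 < G t by near: t; exact: cvg_at_right_filter N.
  have f0 : f 0 = 0 by rewrite /f scale0r addr0 mulr0 !subrr.
  split=> //.
    by have := fE t; rewrite f0 !subr0 => ->; rewrite mulr_gt0.
  have H (x y u : R) : t < rho - `|x - y| -> `|u| <= 1 -> `|x + t * u - y| <= rho.
    move=> txy u1; rewrite addrAC (le_trans (ler_normD _ _))// normrM (gtr0_norm t0).
    have : t * `|u| <= t * 1 by apply: ler_wpM2l => //; exact: ltW.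
    lra.
  by apply/KP; split; apply: H => //; near: t; apply: nbhs_right_lt; rewrite subr_gt0.
have Kt' : w + t *: g w \in K by rewrite inE.
have := wmax _ Kt'.
have : norm2 (w + t *: g w - z) <= norm2 (w - z) + t.
  rewrite addrAC (le_trans (norm2D _ _))// lerD2l norm2Z (gtr0_norm t0).
  by rewrite /norm2 g1// sqrtr1 mulr1.
have e10 : 0 < 1 - e by lra.
rewrite -(ler_pM2l e10) => H1 H2; move: ft; rewrite /f; lra.
Unshelve. all: by end_near. Qed.

(** The case e = 0 of [boundary_max]. No subsequence is extracted: the maximum of psi minus the
    distance over the far points of the box is compared with the point that [boundary_max] gives for
    small [d]. *)
Let boundary_point : exists w, [/\ K w, rho <= norm2 (w - z) &
  psi z + norm2 (w - z) <= psi w].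
Proof.
pose K' := K `&` [set w | rho <= norm2 (w - z)].
have h0 : 0 < 2^-1 :> R by rewrite invr_gt0.
have h1 : 2^-1 < 1 :> R by rewrite invf_lt1// ltr1n.
have K0 : K' !=set0.
  by have [|w [Kw wz _]] := @boundary_max 2^-1; [rewrite h0|exists w].
have compK : compact K'.
  apply: (@subclosed_compact _ _ K); [|exact: compact_box|exact: subIsetl].
  apply: closedI.
    by apply: compact_closed; [exact: (@norm_hausdorff R (R * R)%type)|exact: compact_box].
  rewrite (_ : [set w | _] = (fun w => norm2 (w - z)) @^-1` [set x | rho <= x])//.
  by apply: closed_comp; [move=> w _; exact: continuous_norm2B|exact: closed_ge].
have cK : {within K', continuous (fun w => psi w - 1 * norm2 (w - z))}.
  by apply: continuous_in_subspaceT => w; rewrite inE => -[/KP[w1 w2] _]; apply: cN; exact: zr.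
have [w] := compact_EVT_max K0 compK cK.
rewrite inE => -[Kw wrho] wmax; exists w; split=> //.
rewrite -lerBrDr; apply/ler_addgt0Pr => e e0.
(* Points of the box lie within [2 * rho] of [z], so lowering the slope by [d] costs at most [e];
   [2^-1] keeps [d] below 1. *)
pose d := Num.min 2^-1 (e / (2 * rho)).
have d01 : 0 < d < 1.
  by rewrite /d lt_min gt_min h0 h1 divr_gt0 ?mulr_gt0.
have de : d * (2 * rho) <= e.
  by rewrite -ler_pdivlMr ?mulr_gt0// /d ge_min lexx orbT.
have [w' [Kw' w'rho]] := boundary_max d01.
have w'K : w' \in K' by rewrite inE.
have := wmax _ w'K; rewrite !mul1r => H1 H2.
have : norm2 (w' - z) <= 2 * rho.
  by have /KP[w1 w2] := Kw'; rewrite (le_trans (norm2_le _))//= mulr_natl mulr2n lerD.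
have /andP[d0 _] := d01.
rewrite -(ler_pM2l d0); lra.
Qed.

(** A 1-Lipschitz function that gains the full distance from [z] to [w] grows at unit rate along the
    whole segment; a unit gradient with component 1 along the unit vector [e] equals [e]. *)
Lemma eikonal_half_line t : 0 <= t < rho -> g (z + t *: g z) = g z.
Proof.
have [w [/KP[w1 w2] wrho psiw]] := boundary_point.
pose d := norm2 (w - z); pose e := d^-1 *: (w - z).
have d0 : 0 < d by exact: lt_le_trans wrho.
have wE : w = z + d *: e.
  by rewrite /e scalerA divff ?gt_eqF// scale1r addrC subrK.
have e1 : norm2 e = 1.
  by rewrite /e norm2Z gtr0_norm ?invr_gt0// -/d mulVf// gt_eqF.
have ee : dot e e = 1 by rewrite -norm2_sqr e1 expr1n.
have wr := zr w1 w2.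
have zzr : ball z0 r z by apply: zr; rewrite subrr normr0 ltW.
have inb s : 0 <= s <= d -> ball z0 r (z + s *: e).
  move=> /andP[s0 sd].
  have -> : z + s *: e = z + (s / d) *: (w - z).
    by rewrite /e scalerA.
  apply: ball_convex => //; rewrite divr_ge0 ?(ltW d0)//=.
  by rewrite ler_pdivrMr// mul1r.
have psiE s : 0 <= s <= d -> psi (z + s *: e) - psi z - s = 0.
  move=> sd; have sr := inb s sd; have /andP[s0 sd'] := sd.
  have H1 := eikonal_lipschitz E zzr sr.
  have H2 := eikonal_lipschitz E sr wr.
  have zse : z + s *: e - z = s *: e by rewrite addrC addKr.
  rewrite zse norm2Z e1 mulr1 ger0_norm// in H1.
  have wse : w - (z + s *: e) = (d - s) *: e.
    by rewrite wE scalerBl opprD addrACA subrr add0r.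
  rewrite wse norm2Z e1 mulr1 ger0_norm ?subr_ge0// in H2.
  move: psiw; rewrite -/d; lra.
have ge s : 0 <= s < d -> g (z + s *: e) = e.
  move=> /andP[s0 sd]; have [C g1] := E.
  have sr : ball z0 r (z + s *: e) by apply: inb; rewrite s0 ltW.
  have D := is_deriveB (is_deriveB (eikonal_affine E sr)
    (is_derive_cst (psi z) s (1 : R))) (is_derive_id s (1 : R)).
  have H : dot (g (z + s *: e)) e - 0 - 1 = 0.
    apply: (is_derive_zero_right D sd) => s' /andP[ss' s'd].
    by apply: psiE; rewrite (le_trans s0 ss') ltW.
  apply: unit_eq => //; first exact: g1.
  by move: H; lra.
have gz : g z = e.
  by have := ge 0; rewrite scale0r addr0; apply; rewrite lexx.
move=> /andP[t0 trho]; rewrite gz ge// t0/=.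
exact: lt_le_trans wrho.
Qed.

End line.

(** Negative [t] are reached by applying the half-line to [- psi], whose gradient is [- g]. *)
Lemma eikonal_line z0 z r rho psi g t : eikonal z0 r psi g ->
  (forall w, `|w.1 - z.1| <= rho -> `|w.2 - z.2| <= rho -> ball z0 r w) ->
  `|t| < rho -> g (z + t *: g z) = g z.
Proof.
move=> E zr trho.
have rho0 : 0 < rho by exact: le_lt_trans trho.
have [t0|t0] := leP 0 t.
  by apply: (eikonal_half_line E rho0 zr); rewrite t0 -(ger0_norm t0).
have := @eikonal_half_line _ _ _ _ _ _ (eikonalN E) rho0 zr (- t).
rewrite scalerN scaleNr opprK => H; apply: oppr_inj; apply: H.
by rewrite oppr_ge0 (ltW t0)/= -(ltr0_norm t0).
Qed.

End Eikonal.

(** * H-minimal graphs *)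

Section Graph.
Variables (R : realType) (Omega : set (R * R)) (u : R * R -> R).
Implicit Types (z w v : R * R) (s t : R).
Hypotheses (oO : open Omega) (u_C1 : Cn 1 Omega u).
Hypothesis nonchar : forall z, Omega z -> ~ characteristic u z.

Definition grad z : R * R := ('D_(e1 R) u z, 'D_(e2 R) u z).

Lemma C1_grad : C1_on Omega u grad.
Proof.
have [_ du] := u_C1; have [d1 [c1 _]] := du (e1 R); have [d2 [c2 _]] := du (e2 R).
move=> z Oz; split.
- by apply/derivableP; exact: d1.
- by apply/derivableP; exact: d2.
- exact: (cvg_pair (c1 z Oz) (c2 z Oz)).
Qed.

Lemma derive_defining_fun z v t : derivable u z v ->
  'D_(v, 0) (defining_fun u) (z, t) = - 'D_v u z.
Proof.
move=> dv; suff H : is_derive (z, t) (v, 0) (defining_fun u) (- 'D_v u z).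
  by case: H.
apply/is_deriveP; have /is_deriveP H := derivableP dv.
have -> : (fun h : R => h^-1 *: ((defining_fun u \o shift (z, t)) (h *: (v, 0)) -
    defining_fun u (z, t))) =
    (fun h => - (h^-1 *: ((u \o shift z) (h *: v) - u z))).
  apply/funext => h; rewrite /defining_fun /= /GRing.scale /=; ring.
exact: cvgN.
Qed.

Lemma derive_defining_fun_t z t : 'D_(0, 1) (defining_fun u) (z, t) = 1.
Proof.
suff H : is_derive (z, t) (0, 1) (defining_fun u) 1 by case: H.
apply/is_deriveP.
have -> : (fun h : R => h^-1 *: ((defining_fun u \o shift (z, t)) (h *: (0, 1)) -
    defining_fun u (z, t))) = (fun h => h^-1 * h).
  apply/funext => h; rewrite /defining_fun /=.
  have -> : h *: 0 + z = z by rewrite scaler0 add0r.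
  rewrite /GRing.scale /=; ring.
apply: cvg_near_cst; near=> h; rewrite mulVf//.
by near: h; exact: nbhs_dnbhs_neq.
Unshelve. all: by end_near. Qed.

Lemma pE z : Omega z -> p u z = - (grad z).1 - z.2 / 2.
Proof.
move=> Oz; have [[d1 _] _ _] := C1_grad Oz.
by rewrite /p /X1 derive_defining_fun// derive_defining_fun_t mulr1.
Qed.

Lemma qE z : Omega z -> q u z = - (grad z).2 + z.1 / 2.
Proof.
move=> Oz; have [_ [d2 _] _] := C1_grad Oz.
by rewrite /q /X2 derive_defining_fun// derive_defining_fun_t mulr1.
Qed.

Definition speed z : R := Num.sqrt (p u z ^+ 2 + q u z ^+ 2).

Lemma speed_gt0 z : Omega z -> 0 < speed z.
Proof.
move=> Oz; rewrite /speed sqrtr_gt0 lt_def addr_ge0 ?sqr_ge0// andbT.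
apply/negP; rewrite paddr_eq0 ?sqr_ge0// !sqrf_eq0 => /andP[/eqP p0 /eqP q0].
exact: (nonchar Oz).
Qed.

Lemma p_speed z : Omega z -> p u z = speed z * (nuX u z).1.
Proof. by move=> /speed_gt0 s0; rewrite /= /pbar mulrC divfK// gt_eqF. Qed.

Lemma q_speed z : Omega z -> q u z = speed z * (nuX u z).2.
Proof. by move=> /speed_gt0 s0; rewrite /= /qbar mulrC divfK// gt_eqF. Qed.

Lemma nuX_unit z : Omega z -> dot (nuX u z) (nuX u z) = 1.
Proof.
move=> Oz; have s0 := speed_gt0 Oz.
rewrite /dot /nuX /pbar /qbar /= -/(speed z).
have -> : p u z / speed z * (p u z / speed z) + q u z / speed z * (q u z / speed z) =
   (p u z ^+ 2 + q u z ^+ 2) / speed z ^+ 2.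
  by field; rewrite gt_eqF.
rewrite sqr_sqrtr ?addr_ge0 ?sqr_ge0// divff//.
by move: s0; rewrite sqrtr_gt0 => /gt_eqF ->.
Qed.

Lemma continuous_nuX z : Omega z -> {for z, continuous (nuX u)}.
Proof.
move=> Oz; have [_ _ cg] := C1_grad Oz.
have cg1 : (fun w => (grad w).1) @ z --> (grad z).1.
  by apply: (cvg_comp _ _ cg (_ : fst @ grad z --> (grad z).1)); exact: cvg_fst.
have cg2 : (fun w => (grad w).2) @ z --> (grad z).2.
  by apply: (cvg_comp _ _ cg (_ : snd @ grad z --> (grad z).2)); exact: cvg_snd.
have N : \forall w \near z, Omega w by exact: open_nbhs_nbhs.
have cp : p u @ z --> p u z.
  rewrite pE//; apply: (@cvg_trans _ ((fun w => - (grad w).1 - w.2 / 2) @ z)).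
    by apply: near_eq_cvg; near=> w; rewrite pE//; near: w.
  have c2 : (fun w : R * R => w.2 / 2) @ z --> z.2 / 2.
    by apply: cvgM; [exact: cvg_snd|exact: cvg_cst].
  exact: (cvgB (cvgN cg1) c2).
have cq : q u @ z --> q u z.
  rewrite qE//; apply: (@cvg_trans _ ((fun w => - (grad w).2 + w.1 / 2) @ z)).
    by apply: near_eq_cvg; near=> w; rewrite qE//; near: w.
  have c1 : (fun w : R * R => w.1 / 2) @ z --> z.1 / 2.
    by apply: cvgM; [exact: cvg_fst|exact: cvg_cst].
  exact: (cvgD (cvgN cg2) c1).
have cs : (fun w => (speed w)^-1) @ z --> (speed z)^-1.
  apply: cvgV; first by rewrite gt_eqF// speed_gt0.
  apply: (@continuous_comp _ _ _ (fun w => p u w ^+ 2 + q u w ^+ 2) Num.sqrt).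
    exact: (cvgD (cvgM cp cp) (cvgM cq cq)).
  exact: sqrt_continuous.
exact: (cvg_pair (cvgM cp cs) (cvgM cq cs)).
Unshelve. all: by end_near. Qed.

Lemma gradE z : Omega z ->
  grad z = (- speed z * (nuX u z).1 - z.2 / 2, - speed z * (nuX u z).2 + z.1 / 2).
Proof.
move=> Oz; have := pE Oz; have := qE Oz; rewrite p_speed// q_speed// => E2 E1.
move: (grad z) E1 E2 => [a b] E1 E2; rewrite !mulNr E1 E2 /=.
by congr pair; ring.
Qed.

(** In [gradE] the term in [speed] is parallel to nu_X and drops out along the ruling. The rest
    contributes - <z + t n, nu> / 2, independent of t because n is orthogonal to nu. *)
Lemma u_ruling z r :
  (forall t, `|t| <= `|r| -> Omega (z + t *: perp (nuX u z)) /\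
     nuX u (z + t *: perp (nuX u z)) = nuX u z) ->
  u (z + r *: perp (nuX u z)) = u z - r / 2 * dot z (nuX u z).
Proof.
move=> H; set n := perp (nuX u z).
have Oz : Omega z.
  by have [] := H 0; rewrite ?normr0// scale0r addr0.
have d t : `|t - 0| <= `|r - 0| ->
    is_derive t (1 : R) (fun t => u (z + t *: n)) (- (dot z (nuX u z) / 2)).
  rewrite !subr0 => /H[Ot nut].
  have D := C1_chain (c := fun t => z + t *: n) oO C1_grad Ot (is_derive_affine z n t).
  apply: (is_derive_eq D); rewrite gradE// nut /dot /n /perp /= /GRing.scale /=.
  have := nuX_unit Oz; rewrite /dot; set a := (nuX u z).1; set b := (nuX u z).2.
  move=> ab; ring.
have [c _] := MVT_between d.
rewrite scale0r addr0 subr0 => /eqP; rewrite subr_eq => /eqP ->.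
by ring.
Qed.

Hypothesis minimal : Hminimal Omega u.

Lemma perp_unit v w : dot (perp v) (perp w) = dot v w.
Proof. by rewrite /dot /perp /=; ring. Qed.

(** [Hminimal] is the weak closedness of (qbar, - pbar), which is [perp] of nu_X, so [box_potential]
    applies. *)
Lemma nuX_potential z0 : Omega z0 -> exists2 r, 0 < r & ball z0 r `<=` Omega /\
  exists psi, eikonal z0 r psi (fun z => perp (nuX u z)).
Proof.
move=> Oz0; have /nbhs_ballP[e /= e0 eO] := open_nbhs_nbhs (conj oO Oz0).
have e20 : 0 < e / 2 by lra.
exists (e / 2) => //; split.
  by apply: subset_trans eO => w /ballE2[w1 w2]; apply/ballE2; split; lra.
have cnu z : Omega z -> {for z, continuous (pbar u)} /\ {for z, continuous (qbar u)}.
  move=> /continuous_nuX cn; split.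
    by apply: (cvg_comp _ _ cn (_ : fst @ nuX u z --> (nuX u z).1)); exact: cvg_fst.
  by apply: (cvg_comp _ _ cn (_ : snd @ nuX u z --> (nuX u z).2)); exact: cvg_snd.
have sub : box (z0.1 - e / 2) (z0.1 + e / 2) (z0.2 - e / 2) (z0.2 + e / 2) `<=` Omega.
  apply: subset_trans eO => -[x y] [] /=; rewrite !in_itv/= => /andP[? ?] /andP[? ?].
  by apply/ballE2 => /=; split; rewrite ltr_norml; lra.
have [||psi psiP] := @box_potential R Omega (pbar u) (qbar u)
  (z0.1 - e / 2) (z0.1 + e / 2) (z0.2 - e / 2) (z0.2 + e / 2) _ _ sub
  (fun z Oz => (cnu z Oz).1) (fun z Oz => (cnu z Oz).2) minimal; [lra|lra|].
have eO' z : ball z0 (e / 2) z -> Omega z.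
  by move=> /ballE2[z1 z2]; apply: eO; apply/ballE2; split; lra.
exists psi; split=> z zb; last by rewrite perp_unit nuX_unit//; exact: eO'.
have [] := psiP z.1 z.2.
- by move: zb => /ballE2[]; rewrite ltr_norml; lra.
- by move: zb => /ballE2[_]; rewrite ltr_norml; lra.
rewrite -surjective_pairing => d1 d2; split=> //.
have [cp cq] := cnu z (eO' z zb).
exact: (cvg_pair cq (cvgN cp)).
Qed.

(** The same [r] serves all points near [z0]: neighbouring rulings have a common length, so they can
    be compared at a fixed position. *)
Lemma nuX_ruling z0 : Omega z0 -> exists2 r, 0 < r & forall z t,
  ball z0 r z -> `|t| < r -> Omega (z + t *: perp (nuX u z)) /\
  nuX u (z + t *: perp (nuX u z)) = nuX u z.
Proof.
move=> Oz0; have [r r0 [rO [psi E]]] := nuX_potential Oz0.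
have r30 : 0 < r / 3 by lra.
exists (r / 3) => // z t zr tr.
have zr3 w : `|w.1 - z.1| <= r / 3 -> `|w.2 - z.2| <= r / 3 -> ball z0 r w.
  move: zr => /ballE2[z1 z2] w1 w2.
  have H (x y x0 : R) : `|y - x0| < r / 3 -> `|x - y| <= r / 3 -> `|x - x0| < r.
    move=> H1 H2; rewrite (le_lt_trans (ler_distD y _ _))//; lra.
  by apply/ballE2; split; [exact: (H _ z.1)|exact: (H _ z.2)].
have := eikonal_line E zr3 tr.
set w := z + _ => nuw; split.
  have [C g1] := E.
  have Oz : Omega z.
    by apply: rO; apply: zr3; rewrite subrr normr0 ltW.
  have [n1 n2] : `|(perp (nuX u z)).1| <= 1 /\ `|(perp (nuX u z)).2| <= 1.
    by apply: unit_norm1; rewrite perp_unit nuX_unit.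
  apply: rO; apply: zr3; rewrite /w /= addrC addKr normrM.
    by rewrite -[leRHS]mulr1 ler_pM// ltW.
  by rewrite -[leRHS]mulr1 ler_pM// ltW.
by move: nuw; rewrite /perp => -[? /oppr_inj ?]; apply: injective_projections.
Qed.

Lemma integral_curve_straight (I : set R) (c : R -> R * R) :
  integral_curve Omega (fun z => perp (nuX u z)) I c -> straight I c.
Proof.
move=> [[oI iI] dc].
have [[s0 Is0]|I0] := pselect (exists s, I s); last first.
  exists 0, (e1 R); split; last by move=> s Is; exfalso; apply: I0; exists s.
  by apply/eqP => -[/eqP]; rewrite oner_eq0.
pose g z := perp (nuX u z).
(* A potential exists only locally. Local constancy of the direction is then propagated along [I] as
   a zero derivative. *)
have loc s : I s -> \forall t \near s, g (c s) = g (c t).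
  move=> Is; have [Ocs ds] := dc s Is.
  have [r r0 [rO [psi E]]] := nuX_potential Ocs.
  have cc := is_derive_continuous ds.
  have r20 : 0 < r / 2 by lra.
  have N : \forall t \near s, I t /\ ball (c s) (r / 2) (c t).
    near=> t; split; near: t; first exact: open_nbhs_nbhs.
    by apply: cc; exact: nbhsx_ballx.
  have /nbhs_ballP[d /= d0 D] := N.
  apply/nbhs_ballP; exists d; first exact: d0.
  move=> t st.
  have D' x : `|s - x| < d -> I x /\ ball (c s) (r / 2) (c x) by exact: D.
  have [st'|ts] := leP s t.
    apply: (eikonal_gradient_curve E st') => x /andP[sx xt];
      have [Ix Bx] : I x /\ ball (c s) (r / 2) (c x) by
        apply: D'; rewrite (le_lt_trans _ st)// ler0_norm ?subr_le0// ler0_norm ?subr_le0//; lra.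
      exact: Bx.
    by have [] := dc x Ix.
  apply/esym; apply: (eikonal_gradient_curve E (ltW ts)) => x /andP[sx xt];
    have [Ix Bx] : I x /\ ball (c s) (r / 2) (c x) by
      apply: D'; rewrite (le_lt_trans _ st)// ger0_norm ?subr_ge0// ger0_norm ?subr_ge0//; lra.
    exact: Bx.
  by have [] := dc x Ix.
have gc s : I s -> g (c s) = g (c s0).
  have mono a b : a <= b -> I a -> I b -> g (c a) = g (c b).
    move=> ab Ia Ib.
    have ds x : a <= x <= b -> is_derive x (1 : R) (fun t => g (c t)) 0.
      move=> axb; have Ix := iI a b Ia Ib x axb.
      exact: near_eq_is_derive (loc x Ix) (is_derive_cst (g (c x)) x (1 : R)).
    apply: injective_projections.
      by apply: (is_derive0_eq (f := fun t => (g (c t)).1) ab) => x /ds/is_derive_curve[].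
    by apply: (is_derive0_eq (f := fun t => (g (c t)).2) ab) => x /ds/is_derive_curve[].
  move=> Is; have [s0s|/ltW ss0] := leP s s0; first exact: mono.
  by apply/esym; exact: mono.
pose v := g (c s0).
exists (c s0 - s0 *: v), v; split.
  apply/eqP => v0; have [Os0 _] := dc s0 Is0.
  have : dot v v = 1 by rewrite /v /g perp_unit nuX_unit.
  by rewrite v0 /dot /= mulr0 addr0 => /esym/eqP; rewrite oner_eq0.
have mono a b : a <= b -> I a -> I b -> c a - a *: v = c b - b *: v.
  move=> ab Ia Ib.
  have ds x : a <= x <= b -> is_derive x (1 : R) (fun t => c t - t *: v) 0.
    move=> axb; have Ix := iI a b Ia Ib x axb.
    have [_ dx] := dc x Ix; rewrite -/(g (c x)) gc// in dx.
    have da := is_derive_affine 0 v x.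
    have -> : (fun t => c t - t *: v) = (fun t => c t - (0 + t *: v)).
      by apply/funext => t; rewrite add0r.
    by apply: (is_derive_eq (is_deriveB dx da)); rewrite subrr.
  apply: injective_projections.
    by apply: (is_derive0_eq (f := fun t => (c t - t *: v).1) ab) => x /ds/is_derive_curve[].
  by apply: (is_derive0_eq (f := fun t => (c t - t *: v).2) ab) => x /ds/is_derive_curve[].
move=> s Is; have -> : c s0 - s0 *: v = c s - s *: v.
  have [s0s|/ltW ss0] := leP s0 s; first exact: mono.
  by apply/esym; exact: mono.
by rewrite subrK.
Unshelve. all: by end_near. Qed.

End Graph.

(** * Second-order regularity of seed curves *)

Lemma orthogonal_decomposition (R : realType) (v m : R * R) :
  dot v m = 0 -> dot m m != 0 -> v = (dot v (perp m) / dot m m) *: perp m.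
Proof.
case: v m => [a b] [m1 m2]; rewrite /dot /perp /= => vm mm.
apply: injective_projections; rewrite /= /GRing.scale /= mulrAC;
  apply: (canRL (mulfK mm)); apply/eqP; rewrite -subr_eq0; apply/eqP.
  by transitivity (m1 * (a * m1 + b * m2)); [ring|rewrite vm mulr0].
by transitivity (m2 * (a * m1 + b * m2)); [ring|rewrite vm mulr0].
Qed.

(* [A], [A'] stand for the unit tangents of the seed curve at two parameters, [G], [G']
   for its points, [U] for the increment of [u] along it and [r] for the position on
   the rulings. *)
Lemma ruling_difference (R : realType) (r k : R) (S G G' A A' : R * R) (U : R) :
  let M := 2^-1 *: (A' + A) in
  let den := r * dot S M - r / 2 * dot G (perp M) in
  k != 0 -> dot A A = 1 -> dot A' A' = 1 -> dot M M != 0 -> den != 0 ->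
  U - r / 2 * (dot G' A' - dot G A) = dot S (G' + r *: perp A' - (G + r *: perp A)) ->
  - ((k * U - r / 2 * dot (k *: (G' - G)) A' - dot S (k *: (G' - G))) / den) *: perp M =
  k *: (A' - A).
Proof.
move=> M den k0 AA AA' MM d0 E.
(* The tangents are unit vectors, so their difference is orthogonal to their midpoint [M]. A single
   scalar [kap] is unknown, and [E] is linear in it with coefficient [den]. *)
pose kap := - dot (A' - A) (perp M) / dot M M.
have MA : dot (A' - A) M = 0.
  have : dot A' A' - dot A A = 0 by rewrite AA AA' subrr.
  by rewrite /M /dot /= /GRing.scale /=; lra.
have kE : A' - A = - kap *: perp M.
  by rewrite /kap -!mulNr opprK; exact: orthogonal_decomposition.
have nE : perp A' - perp A = kap *: M.
  have -> : perp A' - perp A = perp (A' - A).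
    by apply: injective_projections; rewrite /perp /=; ring.
  by rewrite kE; apply: injective_projections; rewrite /perp /= /GRing.scale /=; ring.
have NE : U - r / 2 * dot (G' - G) A' - dot S (G' - G) = kap * den.
  have H1 : dot G' A' - dot G A = dot (G' - G) A' + dot G (A' - A).
    by rewrite /dot /=; ring.
  have H2 : dot S (G' + r *: perp A' - (G + r *: perp A)) =
      dot S (G' - G) + r * dot S (perp A' - perp A).
    by rewrite /dot /perp /= /GRing.scale /=; ring.
  have H3 : dot G (A' - A) = - kap * dot G (perp M).
    by rewrite kE /dot /perp /= /GRing.scale /=; ring.
  have H4 : dot S (perp A' - perp A) = kap * dot S M.
    by rewrite nE /dot /perp /= /GRing.scale /=; ring.
  rewrite H1 H2 H3 H4 in E; rewrite /den; lra.
have -> : k * U - r / 2 * dot (k *: (G' - G)) A' - dot S (k *: (G' - G)) =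
    k * (U - r / 2 * dot (G' - G) A' - dot S (G' - G)).
  by rewrite /dot /= /GRing.scale /=; ring.
by rewrite NE kE scalerA mulrA mulfK// mulrN.
Qed.

Section Regularity.
Variables (R : realType) (Omega : set (R * R)) (u : R * R -> R).
Implicit Types (z w v : R * R) (s t : R).
Hypotheses (oO : open Omega) (u_C1 : Cn 1 Omega u).
Hypothesis nonchar : forall z, Omega z -> ~ characteristic u z.
Hypothesis minimal : Hminimal Omega u.
Variables (I : set R) (gamma : R -> R * R).
Hypothesis seed : seed_curve Omega u I gamma.

Let T s := nuX u (gamma s).
Let n s := perp (T s).

Let oI : open I. Proof. by case: seed => -[]. Qed.

Let gammaO s : I s -> Omega (gamma s). Proof. by move=> Is; case: seed => _ /(_ s Is)[]. Qed.

Let dgamma s : I s -> is_derive s (1 : R) gamma (T s).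
Proof. by move=> Is; case: seed => _ /(_ s Is)[]. Qed.

Let cgamma s : I s -> {for s, continuous gamma}.
Proof. by move=> /dgamma; exact: is_derive_continuous. Qed.

Let cT s : I s -> {for s, continuous T}.
Proof.
move=> Is; apply: (@continuous_comp _ _ _ gamma (nuX u)); first exact: cgamma.
by apply: (continuous_nuX oO u_C1 nonchar); exact: gammaO.
Qed.

Let TT s : I s -> dot (T s) (T s) = 1.
Proof. by move=> /gammaO Os; exact: (nuX_unit nonchar). Qed.

(* the factors of [- perp (T s)] in the derivative of [T], obtained by solving for the
   curvature the derivative in [s] of the identity [u_ruling] *)
Let num r s := dot (grad u (gamma s)) (T s) - r / 2 - dot (grad u (gamma s + r *: n s)) (T s).
Let den r s := r * dot (grad u (gamma s + r *: n s)) (T s) - r / 2 * dot (gamma s) (n s).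

Let cvg_perp (F : set_system R) (FF : Filter F) (f : R -> R * R) a :
  f @ F --> a -> (fun s => perp (f s)) @ F --> perp a.
Proof.
move=> fa.
have f1 : (fun s => (f s).1) @ F --> a.1.
  by apply: (cvg_comp _ _ fa (_ : fst @ a --> a.1)); exact: cvg_fst.
have f2 : (fun s => (f s).2) @ F --> a.2.
  by apply: (cvg_comp _ _ fa (_ : snd @ a --> a.2)); exact: cvg_snd.
exact: (cvg_pair f2 (cvgN f1)).
Qed.

(** The difference quotient of [T] is the expression of [ruling_difference] with k = 1/h, whose
    ingredients converge. The condition near [s] says that the rulings there reach position [r]. *)
Let is_derive_T r s : r < 0 -> I s ->
  (\forall t \near s, I t /\ (forall x, `|x| <= `|r| ->
     Omega (gamma t + x *: n t) /\ nuX u (gamma t + x *: n t) = T t)) ->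
  den r s != 0 /\ is_derive s (1 : R) T (- (num r s / den r s) *: n s).
Proof.
move=> r0 Is N.
have [_ Ns] := nbhs_singleton N.
have [Or nur] := Ns r (lexx _).
set z1 := gamma s + r *: n s in Or nur *.
have den0 : den r s != 0.
  (* The terms in [gamma s] cancel; both remaining factors are negative. *)
  have -> : den r s = r * (r / 2 - speed u z1).
    rewrite /den -/z1 (gradE u_C1 nonchar)// nur.
    have := TT Is; set D := speed u z1; clearbody D; rewrite /z1 /n.
    move: (T s) (gamma s) => [a b] [x y].
    rewrite /perp /dot /= /GRing.scale /= => ab.
    transitivity (r * (r / 2 - D) * (a * a + b * b)); first by field.
    by rewrite ab mulr1.
  rewrite mulf_neq0 ?lt_eqF// subr_lt0.
  by have := speed_gt0 nonchar Or; lra.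
split; first exact: den0.
have [S [cS Sz SE]] := C1_slope oO (C1_grad u_C1) Or.
pose M t := 2^-1 *: (T t + T s).
pose q (f : R -> R * R) h := h^-1 *: (f (h + s) - f s).
pose du h := h^-1 * (u (gamma (h + s)) - u (gamma s)).
pose z t := gamma t + r *: n t.
pose numq h := du h - r / 2 * dot (q gamma h) (T (h + s)) - dot (S (z (h + s))) (q gamma h).
pose denq h := r * dot (S (z (h + s))) (M (h + s)) - r / 2 * dot (gamma s) (perp (M (h + s))).
have shift_s : (fun h : R => h + s) @ 0^' --> s.
  have H : (fun h : R => h + s) @ (0 : R) --> s.
    by rewrite -[X in _ --> X](add0r s); apply: cvgD; [exact: cvg_id|exact: cvg_cst].
  by apply: cvg_within_filter H.
have cTs := cvg_comp _ _ shift_s (cT Is).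
have cgs := cvg_comp _ _ shift_s (cgamma Is).
have cM : (fun h => M (h + s)) @ 0^' --> T s.
  have -> : T s = 2^-1 *: (T s + T s).
    by rewrite -[T s]scale1r -scalerDl scalerA; congr (_ *: _); field.
  by apply: cvgZl_tmp; apply: cvgD; [exact: cTs|exact: cvg_cst].
have cz : (fun h => z (h + s)) @ 0^' --> z1.
  by apply: cvgD; [exact: cgs|apply: cvgZl_tmp; exact: cvg_perp].
have cSz : (fun h => S (z (h + s))) @ 0^' --> grad u z1.
  by rewrite -Sz; exact: (cvg_comp _ _ cz cS).
have cqg : q gamma h @[h --> 0^'] --> T s.
  have /is_deriveP H := dgamma Is.
  have -> : q gamma = (fun h : R => h^-1 *: ((gamma \o shift s) (h *: (1 : R)) - gamma s)).
    by apply/funext => h; rewrite /q /= /GRing.scale/= mulr1.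
  exact: H.
have cdu : du h @[h --> 0^'] --> dot (grad u (gamma s)) (T s).
  have /is_deriveP H := C1_chain oO (C1_grad u_C1) (gammaO Is) (dgamma Is).
  have -> : du = (fun h : R => h^-1 *: (((u \o gamma) \o shift s) (h *: (1 : R)) - (u \o gamma) s)).
    by apply/funext => h; rewrite /du /= /GRing.scale/= mulr1.
  exact: H.
have c0 (a : R) : (fun _ : R => a) @ 0^' --> a by exact: cvg_cst.
have c0g : (fun _ : R => gamma s) @ 0^' --> gamma s by exact: cvg_cst.
have cnum : numq h @[h --> 0^'] --> num r s.
  have -> : num r s = dot (grad u (gamma s)) (T s) - r / 2 * dot (T s) (T s) -
      dot (grad u z1) (T s) by rewrite TT// mulr1.
  exact: (cvgB (cvgB cdu (cvgM (c0 (r / 2)) (cvg_dot _ cqg cTs))) (cvg_dot _ cSz cqg)).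
have cden : denq h @[h --> 0^'] --> den r s.
  exact: (cvgB (cvgM (c0 r) (cvg_dot _ cSz cM))
    (cvgM (c0 (r / 2)) (cvg_dot _ c0g (cvg_perp _ cM)))).
have cquot : (- (numq h / denq h) *: perp (M (h + s))) @[h --> 0^'] -->
    - (num r s / den r s) *: n s.
  exact: (cvgZ (cvgN (cvgM cnum (cvgV den0 cden))) (cvg_perp _ cM)).
apply/is_deriveP; apply: cvg_trans cquot; apply: near_eq_cvg.
have NM : \forall h \near 0^', dot (M (h + s)) (M (h + s)) != 0.
  have : (fun h => dot (M (h + s)) (M (h + s))) @ 0^' --> (1 : R).
    by rewrite -(TT Is); exact: (cvg_dot _ cM cM).
  by move=> /cvgr_neq0; apply; rewrite oner_eq0.
have Nd : \forall h \near 0^', denq h != 0 by move/cvgr_neq0: cden; apply.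
have Nr := shift_s _ N.
near=> h.
have h0 : h != 0 by near: h; exact: nbhs_dnbhs_neq.
have dh : denq h != 0 by near: h.
have Mh : dot (M (h + s)) (M (h + s)) != 0 by near: h.
have [Ih Nh] : I (h + s) /\ (forall x, `|x| <= `|r| ->
     Omega (gamma (h + s) + x *: n (h + s)) /\ nuX u (gamma (h + s) + x *: n (h + s)) = T (h + s)).
  by near: h; exact: Nr.
rewrite /= [h *: 1](_ : _ = h); last by rewrite /GRing.scale/= mulr1.
have U1 : u (z (h + s)) = u (gamma (h + s)) - r / 2 * dot (gamma (h + s)) (T (h + s)).
  exact: (u_ruling oO u_C1 nonchar Nh).
have U2 : u z1 = u (gamma s) - r / 2 * dot (gamma s) (T s).
  exact: (u_ruling oO u_C1 nonchar Ns).
have SE1 := SE (z (h + s)); rewrite U1 U2 in SE1.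
apply: ruling_difference; [by rewrite invr_eq0|exact: TT|exact: TT|exact: Mh|exact: dh|].
apply: etrans SE1; move: (u (gamma (h + s))) (u (gamma s)) => a b.
by move: (dot (gamma (h + s)) (T (h + s))) (dot (gamma s) (T s)) => a' b'; ring.
Unshelve. all: by end_near. Qed.

Let cgrad z : Omega z -> {for z, continuous (grad u)}.
Proof. by move=> Oz; have [] := C1_grad u_C1 Oz. Qed.

Let continuous_derive_T s0 : I s0 ->
  is_derive s0 (1 : R) T ('D_1 T s0) /\ {for s0, continuous ('D_1 T)}.
Proof.
move=> Is0; have [rho rho0 H] := nuX_ruling oO u_C1 nonchar minimal (gammaO Is0).
(* Any [r] strictly between [- rho] and 0 would do. Fixed near [s0], it yields one formula for T'
   there, continuous in [s]. *)
pose r := - (rho / 2).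
have r0 : r < 0 by rewrite /r; lra.
have rn : `|r| < rho by rewrite ltr0_norm// /r; lra.
have N : \forall t \near s0, I t /\ (forall x, `|x| <= `|r| ->
     Omega (gamma t + x *: n t) /\ nuX u (gamma t + x *: n t) = T t).
  have NI : \forall t \near s0, I t by exact: open_nbhs_nbhs.
  have NB : \forall t \near s0, ball (gamma s0) rho (gamma t).
    by apply: (cgamma Is0); exact: nbhsx_ballx.
  near=> t; split; first by near: t.
  by move=> x xr; apply: H; [near: t|exact: le_lt_trans rn].
have N2 : \forall s \near s0, is_derive s (1 : R) T (- (num r s / den r s) *: n s).
  (* [is_derive_T] wants its condition on a neighbourhood of each nearby [s], not only of [s0]. *)
  apply: filterS (nbhs_interior N) => s Ns.
  by have [Is _] := nbhs_singleton Ns; have [] := is_derive_T r0 Is Ns.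
have E : {near s0, (fun s => - (num r s / den r s) *: n s) =1 'D_1 T}.
  by apply: filterS N2 => s [].
split; first by have [d _] := nbhs_singleton N2.
have [den0 _] := is_derive_T r0 Is0 N.
have [Or _] := (nbhs_singleton N).2 r (lexx _).
apply: (near_eq_continuous E).
have cn : {for s0, continuous n} by exact: (cvg_perp _ (cT Is0)).
have cg0 : (fun s => grad u (gamma s)) @ s0 --> grad u (gamma s0).
  by apply: (continuous_comp (cgamma Is0)); exact: cgrad (gammaO Is0).
have cz : (fun s => gamma s + r *: n s) @ s0 --> gamma s0 + r *: n s0.
  by apply: cvgD; [exact: cgamma|exact: cvgZl_tmp].
have cg1 : (fun s => grad u (gamma s + r *: n s)) @ s0 --> grad u (gamma s0 + r *: n s0).
  exact: (cvg_comp _ _ cz (cgrad Or)).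
have c0 (a : R) : (fun _ : R => a) @ s0 --> a by exact: cvg_cst.
have cnum : num r @ s0 --> num r s0.
  exact: (cvgB (cvgB (cvg_dot _ cg0 (cT Is0)) (c0 (r / 2))) (cvg_dot _ cg1 (cT Is0))).
have cden : den r @ s0 --> den r s0.
  exact: (cvgB (cvgM (c0 r) (cvg_dot _ cg1 (cT Is0)))
    (cvgM (c0 (r / 2)) (cvg_dot _ (cgamma Is0) cn))).
exact: (cvgZ (cvgN (cvgM cnum (cvgV den0 cden))) cn).
Unshelve. all: by end_near. Qed.

Lemma seed_curve_C2 : Cn 2 I gamma.
Proof.
apply: (CnS_line oI dgamma); apply: (CnS_line oI (fun s Is => (continuous_derive_T Is).1)).
by split=> // s /continuous_derive_T[].
Qed.

Lemma height_C1 h0 : (forall s, I s -> h0 s = u (gamma s)) -> Cn 1 I h0.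
Proof.
move=> h0E.
have d s (Is : I s) := C1_chain oO (C1_grad u_C1) (gammaO Is) (dgamma Is).
apply: (Cn_eq_on (f := u \o gamma) oI); first by move=> s Is; rewrite h0E.
apply: (CnS_line oI d); split=> // s Is.
have cg0 : (fun s => grad u (gamma s)) @ s --> grad u (gamma s).
  by apply: (continuous_comp (cgamma Is)); exact: cgrad (gammaO Is).
exact: (cvg_dot _ cg0 (cT Is)).
Qed.

End Regularity.

(** The chart sends (s, 0) to (gamma s, h0 s) and takes its values in the graph. *)
Lemma seed_parameterization_height (R : realType) (Omega : set (R * R)) (u : R * R -> R)
    I gamma h0 U : seed_parameterization Omega u I gamma h0 U ->
  forall s, I s -> h0 s = u (gamma s).
Proof.
move=> [_ _ U0 [oU _ _ op]] s Is.
have [W _ PW] := op U oU (@subset_refl _ U).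
have : (graph_of Omega u `&` W) (Phi gamma h0 (s, 0)).
  by rewrite -PW; exists (s, 0) => //; exact: U0.
by move=> [[_]] /=; rewrite /h /F /= mul0r mul0r subr0 scale0r addr0.
Qed.

(** * Level curves of an eikonal function, parameterized by arc length *)

Section LevelCurve.
Variables (R : realType) (z0 : R * R) (r : R) (psi : R * R -> R) (g : R * R -> R * R).
Hypotheses (r0 : 0 < r) (E : eikonal z0 r psi g).
Implicit Types (z w v : R * R) (s t x y : R).

(** The inverse of [perp]: when [g] is [perp] of nu_X, the tangent [rot g] of a level curve is nu_X
    itself. *)
Definition rot (v : R * R) : R * R := (- v.2, v.1).

Let f := g z0.
Let e := rot f.
Let pt x y := z0 + x *: e + y *: f.

Let zr : ball z0 r z0. Proof. exact: ballxx. Qed.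

Let ff : dot f f = 1. Proof. by case: E => _; apply. Qed.

Let ee : dot e e = 1. Proof. by rewrite -ff /dot /e /=; ring. Qed.

Let ef : dot e f = 0. Proof. by rewrite /dot /e /=; ring. Qed.

Let pt_coord w : pt (dot (w - z0) e) (dot (w - z0) f) = w.
Proof.
have := ff; rewrite /pt /e; move: f w z0 => [f1 f2] [w1 w2] [x0 y0].
rewrite /dot /= => H; apply: injective_projections; rewrite /= /GRing.scale /=.
  transitivity (x0 + (w1 - x0) * (f1 * f1 + f2 * f2)); first by ring.
  by rewrite H; ring.
transitivity (y0 + (w2 - y0) * (f1 * f1 + f2 * f2)); first by ring.
by rewrite H; ring.
Qed.

Let coord_pt x y : dot (pt x y - z0) e = x /\ dot (pt x y - z0) f = y.
Proof.
have -> : pt x y - z0 = x *: e + y *: f by rewrite /pt addrAC [z0 + _]addrC addrK.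
have D u1 v1 w1 : dot (x *: u1 + y *: v1) w1 = x * dot u1 w1 + y * dot v1 w1.
  by rewrite /dot /= /GRing.scale /=; ring.
by rewrite !D ee ef ff dotC ef !mulr0 !mulr1 addr0 add0r.
Qed.

Let rotE z : rot (g z) = dot (g z) f *: e - dot (g z) e *: f.
Proof.
have := ff; rewrite /e; move: f (g z) => [f1 f2] [g1 g2].
rewrite /dot /rot /= => H; apply: injective_projections; rewrite /= /GRing.scale /=.
  by transitivity (- g2 * (f1 * f1 + f2 * f2)); [rewrite H mulr1|ring].
by transitivity (g1 * (f1 * f1 + f2 * f2)); [rewrite H mulr1|ring].
Qed.

Let pt_near (a x y : R) : `|x| <= a -> `|y| <= a -> 0 < a -> ball z0 (3 * a) (pt x y).
Proof.
move=> xa ya a0; have [e1 e2] := unit_norm1 ee; have [f1 f2] := unit_norm1 ff.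
have H u1 u2 c : `|u1| <= 1 -> `|u2| <= 1 -> `|c + x * u1 + y * u2 - c| < 3 * a.
  move=> u11 u21; have -> : c + x * u1 + y * u2 - c = x * u1 + y * u2 by ring.
  rewrite (le_lt_trans (ler_normD _ _))// !normrM.
  have : `|x| * `|u1| <= a * 1 by apply: ler_pM.
  have : `|y| * `|u2| <= a * 1 by apply: ler_pM.
  lra.
by apply/ballE2; split; exact: H.
Qed.

(** Points with frame coordinates up to [a] are less than [3 * a] away from [z0], so [r / 9] keeps
    the square within [r / 3]. *)
Let small_square : exists a, [/\ 0 < a, a <= r / 9 &
  forall x y, `|x| <= a -> `|y| <= a -> 1 / 2 < dot (g (pt x y)) f].
Proof.
have [C _] := E; have [_ _ cg] := C _ zr.
have N : \forall z \near z0, 1 / 2 < dot (g z) f.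
  have cd : (fun z => dot (g z) f) @ z0 --> (1 : R).
    by rewrite -ff; apply: cvg_dot; [exact: cg|exact: cvg_cst].
  by move/cvgr_gt: cd; apply; lra.
have /nbhs_ballP[d /= d0 D] := N.
exists (Num.min (r / 9) (d / 3)).
have m1 : Num.min (r / 9) (d / 3) <= r / 9 by rewrite ge_min lexx.
have m2 : Num.min (r / 9) (d / 3) <= d / 3 by rewrite ge_min lexx orbT.
have m0 : 0 < Num.min (r / 9) (d / 3) by rewrite lt_min !divr_gt0.
split=> //.
move=> x y xa ya; apply: D; have /ballE2[p1 p2] := pt_near xa ya m0.
have h : 3 * Num.min (r / 9) (d / 3) <= d by lra.
by apply/ballE2; split; exact: lt_le_trans h.
Qed.

Section curve.
Variable a : R.
Hypotheses (a0 : 0 < a) (ar : a <= r / 9).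
Hypothesis slope : forall x y, `|x| <= a -> `|y| <= a -> 1 / 2 < dot (g (pt x y)) f.

Let pt_ball3 x y : `|x| <= a -> `|y| <= a -> ball z0 (r / 3) (pt x y).
Proof.
move=> xa ya; have h : 3 * a <= r / 3 by move: ar; lra.
by have /ballE2[p1 p2] := pt_near xa ya a0; apply/ballE2; split; exact: lt_le_trans h.
Qed.

Let pt_ball x y : `|x| <= a -> `|y| <= a -> ball z0 r (pt x y).
Proof.
move=> xa ya; have h : r / 3 <= r by move: r0; lra.
by have /ballE2[p1 p2] := pt_ball3 xa ya; apply/ballE2; split; exact: lt_le_trans h.
Qed.

Let psi_mono x y1 y2 : `|x| <= a -> `|y1| <= a -> `|y2| <= a -> y1 <= y2 ->
  (y2 - y1) / 2 <= psi (pt x y2) - psi (pt x y1).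
Proof.
move=> xa; rewrite !ler_norml => /andP[y1a _] /andP[_ y2a] y12.
have ya y : y1 <= y <= y2 -> `|y| <= a by rewrite ler_norml; lra.
have d y (y12' : y1 <= y <= y2) := eikonal_affine E (pt_ball xa (ya y y12')).
have [y yy ->] := MVT_is_derive y12 d.
rewrite mulrC ler_wpM2r ?subr_ge0//.
have := slope xa (ya y yy); rewrite /pt; lra.
Qed.

Let psi_lip x x' y : `|x| <= a -> `|x'| <= a -> `|y| <= a ->
  psi (pt x y) - psi (pt x' y) <= `|x - x'|.
Proof.
move=> xa xa' ya.
have := eikonal_lipschitz E (pt_ball xa' ya) (pt_ball xa ya).
have -> : pt x y - pt x' y = (x - x') *: e.
  by rewrite /pt opprD addrACA subrr addr0 opprD addrACA subrr add0r -scalerBl.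
by rewrite norm2Z /norm2 ee sqrtr1 mulr1.
Qed.

Let pt00 : pt 0 0 = z0. Proof. by rewrite /pt !scale0r !addr0. Qed.

(** At abscissa 0 and ordinates [a] and [- a], psi differs from [psi z0] by at least a/2, and a
    shift of the abscissa by less than a/4 cannot undo this. *)
Let b := a / 4.

Let ba x : `|x| < b -> `|x| <= a.
Proof. by move: a0; rewrite /b; lra. Qed.

Let aa : `|a| <= a. Proof. by rewrite gtr0_norm. Qed.
Let naa : `|- a| <= a. Proof. by rewrite normrN. Qed.
Let a00 : `|0 : R| <= a. Proof. by rewrite normr0 ltW. Qed.

Lemma level_ordinate x : `|x| < b -> exists2 y, `|y| < a & psi (pt x y) = psi z0.
Proof.
move=> xb; have xa := ba xb.
have na : - a <= a by move: a0; lra.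
have cy : {within `[- a, a], continuous (fun y => psi (pt x y))}.
  apply: continuous_in_subspaceT => y; rewrite inE/= in_itv/= -ler_norml => ya.
  exact: (is_derive_continuous (eikonal_affine E (pt_ball xa ya))).
have up : psi z0 < psi (pt x a).
  have := psi_mono a00 a00 aa (ltW a0); rewrite pt00.
  have := psi_lip a00 xa aa; rewrite sub0r normrN.
  by move: a0 xb; rewrite /b; lra.
have down : psi (pt x (- a)) < psi z0.
  have na0 : - a <= 0 by move: a0; lra.
  have := psi_mono a00 naa a00 na0; rewrite pt00.
  have := psi_lip xa a00 naa; rewrite subr0.
  by move: a0 xb; rewrite /b; lra.
have [|y] := IVT na cy (v := psi z0).
  by rewrite ge_min le_max (ltW up) (ltW down) orbT.
rewrite in_itv/= => /andP[ya1 ya2] yE; exists y => //.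
rewrite ltr_norml !lt_def ya1 ya2 !andbT; apply/andP; split.
  by apply: contraTneq down => <-; rewrite yE ltxx.
by apply: contraTneq up => ->; rewrite yE ltxx.
Qed.

(** The implicit function, later supplied by choice from [level_ordinate]. *)
Variable G : R -> R.
Hypothesis GP : forall x, `|x| < b -> `|G x| < a /\ psi (pt x (G x)) = psi z0.

Let uniq x y : `|x| < b -> `|y| <= a -> psi (pt x y) = psi z0 -> y = G x.
Proof.
move=> xb ya yE; have xa := ba xb; have [/ltW Ga GE] := GP xb.
have [yG|/ltW Gy] := leP y (G x).
  by have := psi_mono xa ya Ga yG; rewrite yE GE; lra.
by have := psi_mono xa Ga ya Gy; rewrite yE GE; lra.
Qed.

(** Psi gains at least half of any increase of the ordinate and changes by at most the shift of the
    abscissa. *)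
Let G_lip x x' : `|x| < b -> `|x'| < b -> `|G x - G x'| <= 2 * `|x - x'|.
Proof.
have H x1 x2 : `|x1| < b -> `|x2| < b -> G x1 <= G x2 -> G x2 - G x1 <= 2 * `|x1 - x2|.
  move=> b1 b2 G12; have [/ltW G1 E1] := GP b1; have [/ltW G2 E2] := GP b2.
  have := psi_mono (ba b2) G1 G2 G12; rewrite E2 -E1.
  have := psi_lip (ba b1) (ba b2) G1; lra.
move=> xb xb'; have [G12|/ltW G21] := leP (G x) (G x').
  by rewrite ler0_norm ?subr_le0// opprB; exact: H.
by rewrite ger0_norm ?subr_ge0// distrC; exact: H.
Qed.

Let c x := pt x (G x).

Let near_b x : `|x| < b -> \forall t \near x, `|t| < b.
Proof.
move=> xb; near=> t.
have : `|t - x| < b - `|x|.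
  by near: t; apply: cvgr_distC_lt; [exact: cvg_id|rewrite subr_gt0].
by have := ler_normD (t - x) x; rewrite subrK; lra.
Unshelve. all: by end_near. Qed.

Let cG x : `|x| < b -> {for x, continuous G}.
Proof.
move=> xb; apply/cvgrPdist_lt => d d0; near=> t.
have tb : `|t| < b by near: t; exact: near_b.
rewrite (le_lt_trans (G_lip xb tb))// -ltr_pdivlMl//.
by near: t; apply: cvgr_dist_lt; [exact: cvg_id|rewrite mulr_gt0// invr_gt0].
Unshelve. all: by end_near. Qed.

Let cc x : `|x| < b -> {for x, continuous c}.
Proof.
move=> xb; have c0 : (fun _ : R => z0) @ x --> z0 by exact: cvg_cst.
have cx : (fun t : R => t) @ x --> x by exact: cvg_id.
exact: (cvgD (cvgD c0 (cvgZr_tmp (a := e) cx)) (cvgZr_tmp (a := f) (cG xb))).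
Qed.

Let c_ball3 x : `|x| < b -> ball z0 (r / 3) (c x).
Proof. by move=> xb; apply: pt_ball3; [exact: ba|apply: ltW; case: (GP xb)]. Qed.

Let c_ball x : `|x| < b -> ball z0 r (c x).
Proof. by move=> xb; apply: pt_ball; [exact: ba|apply: ltW; case: (GP xb)]. Qed.

Let beta x := dot (g (c x)) f.

Let beta_half x : `|x| < b -> 1 / 2 < beta x.
Proof. by move=> xb; apply: slope; [exact: ba|apply: ltW; case: (GP xb)]. Qed.

Let beta1 x : `|x| < b -> beta x <= 1.
Proof.
move=> xb; rewrite (le_trans (dot_unit_le _ _))//; last by rewrite /norm2 ff sqrtr1.
by case: E => _; apply; exact: c_ball.
Qed.

Let cbeta x : `|x| < b -> {for x, continuous beta}.
Proof.
move=> xb; have [C _] := E; have [_ _ cg] := C _ (c_ball xb).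
apply: cvg_dot; last exact: cvg_cst.
by apply: (continuous_comp (cc xb)); exact: cg.
Qed.

(** Implicit differentiation: psi is constant along [c], so the secant gradient is orthogonal to
    every chord from [c x], which determines the increment of [G]. *)
Let dc x : `|x| < b -> is_derive x (1 : R) c ((beta x)^-1 *: rot (g (c x))).
Proof.
move=> xb; have cxb := c_ball xb; have [C _] := E.
have b0 : beta x != 0 by rewrite gt_eqF//; have := beta_half xb; lra.
have [S [cS Sc SE]] := C1_slope (@open_ball _ z0 r) C cxb.
have -> : (beta x)^-1 *: rot (g (c x)) = e - (dot (g (c x)) e / beta x) *: f.
  rewrite rotE -/(beta x) scalerBr !scalerA mulVf// scale1r.
  by rewrite [_^-1 * _]mulrC.
have shift_x : (fun h : R => h + x) @ 0^' --> x.
  have H : (fun h : R => h + x) @ (0 : R) --> x.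
    by rewrite -[X in _ --> X](add0r x); apply: cvgD; [exact: cvg_id|exact: cvg_cst].
  by apply: cvg_within_filter H.
have cSc : (fun h => S (c (h + x))) @ 0^' --> g (c x).
  by rewrite -Sc; exact: (cvg_comp _ _ (cvg_comp _ _ shift_x (cc xb)) cS).
have c0 v : (fun _ : R => v) @ 0^' --> v by exact: cvg_cst.
have cdotS v : (fun h => dot (S (c (h + x))) v) @ 0^' --> dot (g (c x)) v.
  exact: (cvg_dot _ cSc (c0 v)).
have cf := cdotS f.
have H : (fun h => e - (dot (S (c (h + x))) e / dot (S (c (h + x))) f) *: f) @ 0^' -->
    e - (dot (g (c x)) e / beta x) *: f.
  exact: (cvgB (c0 e) (cvgZr_tmp (a := f) (cvgM (cdotS e) (cvgV b0 cf)))).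
apply/is_deriveP; apply: cvg_trans H; apply: near_eq_cvg.
have Nf : \forall h \near 0^', dot (S (c (h + x))) f != 0.
  by move/cvgr_neq0: cf; apply.
have Nb := shift_x _ (near_b xb).
near=> h.
have h0 : h != 0 by near: h; exact: nbhs_dnbhs_neq.
have Sf : dot (S (c (h + x))) f != 0 by near: h.
have hb : `|h + x| < b by near: h; exact: Nb.
rewrite /= [h *: 1](_ : _ = h); last by rewrite /GRing.scale/= mulr1.
have := SE (c (h + x)).
have [_ ->] := GP hb; have [_ ->] := GP xb.
have dE : c (h + x) - c x = h *: e + (G (h + x) - G x) *: f.
  rewrite /c /pt; move: (G (h + x)) (G x) => G1 G2.
  by apply: injective_projections; rewrite /= /GRing.scale /=; ring.
rewrite dE subrr; move: Sf; move: (S _) (G (h + x) - G x) => S' D Sf.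
have -> : dot S' (h *: e + D *: f) = h * dot S' e + D * dot S' f.
  by rewrite /dot /= /GRing.scale /=; ring.
move=> /esym/eqP; rewrite addr_eq0 => /eqP HE.
have -> : D = - (h * (dot S' e / dot S' f)).
  by apply: (mulIf Sf); rewrite -[LHS]opprK -HE; field.
move: (dot S' e / dot S' f) => q.
by apply: injective_projections; rewrite /= /GRing.scale /=; field.
Unshelve. all: by end_near. Qed.

Let b' := b / 2.
Let b'0 : 0 < b'. Proof. by move: a0; rewrite /b' /b; lra. Qed.
Let b'b x : - b' <= x <= b' -> `|x| < b.
Proof. by rewrite /b' ltr_norml; have := b'0; rewrite /b'; lra. Qed.

(** The speed of [c], frozen outside [- b', b'] so as to be continuous on the whole line. Being at
    least 1, it makes arc length a bijection of the line. *)
Let k x := (beta (clamp (- b') b' x))^-1.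

Let clampb x : `|clamp (- b') b' x| < b.
Proof. by apply: b'b; apply: clampP; have := b'0; lra. Qed.

Let ck : continuous k.
Proof.
move=> x; apply: cvgV; first by rewrite gt_eqF//; have := beta_half (clampb x); lra.
apply: (@continuous_comp _ _ _ (clamp (- b') b') beta); first exact: continuous_clamp.
exact: cbeta.
Qed.

Let k1 x : 1 <= k x.
Proof.
have h := beta_half (clampb x).
by rewrite /k invf_ge1; [exact: beta1|lra].
Qed.

(* arc length along the level set *)
Let L := primitive k.

Let dL x : is_derive x (1 : R) L (k x). Proof. exact: is_derive_primitive. Qed.

Let L0 : L 0 = 0. Proof. by rewrite /L /primitive subrr. Qed.

Let L_growth x y : x <= y -> y - x <= L y - L x.
Proof.
move=> xy; have [t _ ->] := MVT_is_derive xy (fun t _ => dL t).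
by rewrite -[leLHS]mul1r ler_wpM2r ?subr_ge0.
Qed.

Let cL : continuous L. Proof. exact: continuous_is_derive dL. Qed.

(** Since L' >= 1 and L 0 = 0, the values of [L] at [- |s|] and [|s|] enclose [s]. *)
Lemma arc_length_surj s : exists x, L x = s.
Proof.
have s0 : - `|s| <= `|s| by have := normr_ge0 s; lra.
have [|x _ <-] := IVT s0 (continuous_subspaceT cL) (v := s); last by exists x.
have ns : - `|s| <= 0 by rewrite oppr_le0.
have := L_growth (normr_ge0 s); have := L_growth ns; rewrite L0 => H1 H2.
rewrite ge_min le_max; apply/andP; split; apply/orP; [left|right].
  by have := ler_norm (- s); rewrite normrN; lra.
by have := ler_norm s; lra.
Qed.

Variable X : R -> R.
Hypothesis XK : forall s, L (X s) = s.

Let LK x : X (L x) = x.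
Proof.
have := XK (L x); have [xy|/ltW yx] := leP x (X (L x)).
  by have := L_growth xy; lra.
by have := L_growth yx; lra.
Qed.

Let dX s : is_derive s (1 : R) X (k (X s))^-1.
Proof.
rewrite -[s in is_derive s](XK s); apply: (@is_derive_inverse _ L).
- by near=> x; exact: LK.
- by near=> x; exact: cL.
- exact: dL.
- by rewrite gt_eqF// (lt_le_trans ltr01).
Unshelve. all: by end_near. Qed.

Let gamma s := c (X s).
Let I : set R := [set s | - b' < X s < b'].

Let I_open_interval : open_interval I.
Proof.
have -> : I = [set` `]L (- b'), L b'[].
  have mono x y : (x < y) = (L x < L y).
    apply/idP/idP => [xy|]; first by have := L_growth (ltW xy); lra.
    by apply: contraTT; rewrite -!leNgt => yx; have := L_growth yx; lra.
  by apply/seteqP; split=> s; rewrite /I /= in_itv/= (mono (- b')) (mono (X s)) XK.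
by split; [exact: interval_open|exact: interval_is_interval].
Qed.

Let IX s : I s -> `|X s| < b.
Proof. by rewrite /I /= => Is; apply: b'b; lra. Qed.

Let dgamma s : I s -> is_derive s (1 : R) gamma (rot (g (gamma s))).
Proof.
move=> Is; have xb := IX Is.
have kE : (k (X s))^-1 = beta (X s).
  by rewrite /k invrK clamp_id//; move: Is; rewrite /I /=; lra.
have [d1 d2] := (is_derive_curve _ _ _).1 (dc xb).
have b0 : beta (X s) != 0 by rewrite gt_eqF//; have := beta_half xb; lra.
have dXs := dX s; rewrite kE in dXs.
apply/is_derive_curve; split.
  apply: (is_derive_eq (is_derive1_comp d1 dXs)).
  by rewrite /= /GRing.scale /= mulrAC mulVf// mul1r.
apply: (is_derive_eq (is_derive1_comp d2 dXs)).
by rewrite /= /GRing.scale /= mulrAC mulVf// mul1r.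
Qed.

(** The arc-length parameter read off from the abscissa in the frame at [z0]; on the open rectangle
    [N] it inverts [gamma] along the level set. *)
Let lam w := L (dot (w - z0) e).
Let N : set (R * R) := [set w | `|dot (w - z0) e| < b' /\ `|dot (w - z0) f| < a].

Let cdot v : continuous (fun w => dot (w - z0) v).
Proof.
move=> w; apply: cvg_dot; last exact: cvg_cst.
by apply: cvgB; [exact: cvg_id|exact: cvg_cst].
Qed.

Let oN : open N.
Proof.
have o v d : open [set w | `|dot (w - z0) v| < d].
  rewrite (_ : [set w | _] = (fun w => `|dot (w - z0) v|) @^-1` [set t | t < d])//.
  apply: open_comp => [w _|]; last exact: open_lt.
  by apply: (continuous_comp (@cdot v w)); exact: norm_continuous.
exact: openI (o e b') (o f a).
Qed.

(** [lam] and [N] are exported because the openness of [F] needs a continuous inverse of [gamma] on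
    the level set; the radius [r / 3] leaves room for rulings. *)
Lemma level_curve_of : exists (I : set R) (gamma : R -> R * R)
    (lam : R * R -> R) (N : set (R * R)),
  [/\ open_interval I, I 0 /\ gamma 0 = z0,
    forall s, I s -> [/\ ball z0 (r / 3) (gamma s),
      is_derive s (1 : R) gamma (rot (g (gamma s))), psi (gamma s) = psi z0,
      N (gamma s) & lam (gamma s) = s],
    open N /\ continuous lam &
    forall w, N w -> psi w = psi z0 -> I (lam w) /\ gamma (lam w) = w].
Proof.
exists I, gamma, lam, N; split=> //.
- have X0 : X 0 = 0 by have := LK 0; rewrite L0.
  split; first by rewrite /I /= X0; have := b'0; lra.
  have b0 : `|0 : R| < b by apply: b'b; have := b'0; lra.
  by rewrite /gamma X0 /c -(uniq b0 a00) ?pt00.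
- move=> s Is; have xb := IX Is; have [Ga GE] := GP xb.
  have [ce cf] := coord_pt (X s) (G (X s)).
  split.
  + exact: c_ball3.
  + exact: dgamma.
  + exact: GE.
  + by split; rewrite /gamma /c /= ?ce ?cf// ltr_norml; exact: Is.
  + by rewrite /lam /gamma /c ce XK.
- split; first exact: oN.
  by move=> w; apply: (continuous_comp (@cdot e w)); exact: cL.
- move=> w [we wf] pw; rewrite /lam /gamma /I /= LK -ltr_norml; split=> //.
  have web : `|dot (w - z0) e| < b.
    by apply: b'b; rewrite -ler_norml ltW.
  by rewrite /c -(uniq web (ltW wf)) pt_coord.
Qed.

End curve.

Lemma level_curve : exists (I : set R) (gamma : R -> R * R)
    (lam : R * R -> R) (N : set (R * R)),
  [/\ open_interval I, I 0 /\ gamma 0 = z0,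
    forall s, I s -> [/\ ball z0 (r / 3) (gamma s),
      is_derive s (1 : R) gamma (rot (g (gamma s))), psi (gamma s) = psi z0,
      N (gamma s) & lam (gamma s) = s],
    open N /\ continuous lam &
    forall w, N w -> psi w = psi z0 -> I (lam w) /\ gamma (lam w) = w].
Proof.
have [a [a0 ar slope]] := small_square.
have /choice[G GP] : forall x, exists y, `|x| < a / 4 ->
    `|y| < a /\ psi (pt x y) = psi z0.
  move=> x; have [xb|xb] := ltP `|x| (a / 4); last by exists 0.
  by have [y ya yE] := level_ordinate a0 ar slope xb; exists y.
have /choice[X XK] := arc_length_surj a0 ar slope GP.
exact: (level_curve_of a0 ar slope GP XK).
Qed.

End LevelCurve.

(** * The local parameterization by rulings over a seed curve *)

Lemma rot_perp (R : realType) (v : R * R) : rot (perp v) = v.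
Proof. by rewrite /rot /perp /= opprK -surjective_pairing. Qed.

Lemma local_seed_parameterization (R : realType) (Omega : set (R * R)) (u : R * R -> R) :
  open Omega -> Cn 1 Omega u -> (forall z, Omega z -> ~ characteristic u z) ->
  Hminimal Omega u -> forall P : R * R * R, graph_of Omega u P ->
  exists (I : set R) (gamma : R -> R * R) (h0 : R -> R) (U : set (R * R)),
    seed_parameterization Omega u I gamma h0 U /\ (Phi gamma h0 @` U) P.
Proof.
move=> oO u_C1 nonchar minimal [z0 t0] [/= Oz0 ->].
have [r r0 [rO [psi E]]] := nuX_potential oO u_C1 nonchar minimal Oz0.
pose g z := perp (nuX u z).
have [C g1] := E.
have [I [gamma [lam [N [[oI iI] [I0 g0] IP [oN clam] NP]]]]] := level_curve r0 E.
have Igamma s : I s -> ball z0 (r / 3) (gamma s) by move=> /IP[].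
have dgamma s : I s -> is_derive s (1 : R) gamma (nuX u (gamma s)).
  by move=> /IP[_ d _ _ _]; rewrite rot_perp in d.
have psig s : I s -> psi (gamma s) = psi z0 by move=> /IP[].
have r3 : 0 < r / 3 by lra.
(* Rulings of length [r / 3] from the curve stay in [B], and those from [B] stay in the ball of
   radius [r]; the inverse of [F] travels back along the latter. *)
pose B := ball z0 (r / 3 + r / 3).
have near_B z w : B z -> `|w.1 - z.1| <= r / 3 -> `|w.2 - z.2| <= r / 3 -> ball z0 r w.
  move=> /ballE2[z1 z2] w1 w2; apply/ballE2.
  have H (x y c : R) : `|y - c| < r / 3 + r / 3 -> `|x - y| <= r / 3 -> `|x - c| < r.
    by move=> H1 H2; rewrite (le_lt_trans (ler_distD y _ _))//; lra.
  by split; [exact: H w1|exact: H w2].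
have Br z : B z -> ball z0 r z.
  by move=> Bz; apply: (near_B z) => //; rewrite subrr normr0 ltW.
have gg z : ball z0 r z -> `|(g z).1| <= 1 /\ `|(g z).2| <= 1.
  by move=> /g1; exact: unit_norm1.
have line_in z t : B z -> `|t| < r / 3 -> ball z0 r (z + t *: g z).
  move=> Bz tr; have [n1 n2] := gg z (Br z Bz).
  apply: (near_B z) => //; rewrite /= addrC addKr normrM -[leRHS]mulr1.
    by apply: ler_pM => //; exact: ltW.
  by apply: ler_pM => //; exact: ltW.
have line_g z t : B z -> `|t| < r / 3 -> g (z + t *: g z) = g z.
  move=> Bz tr; exact: (eikonal_line E (fun w => @near_B z w Bz) tr).
have line_psi z t : B z -> `|t| < r / 3 -> psi (z + t *: g z) = psi z + t.
  move=> Bz tr.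
  have d x : `|x - 0| <= `|t - 0| -> is_derive x (1 : R) (fun x => psi (z + x *: g z)) 1.
    rewrite !subr0 => xt; have xr := le_lt_trans xt tr.
    apply: (is_derive_eq (eikonal_affine E (line_in z x Bz xr))).
    by rewrite -[perp _]/(g _) line_g//; exact: g1 (Br z Bz).
  have [c _] := MVT_between d.
  by rewrite scale0r addr0 subr0 mul1r => H; apply/eqP; rewrite [psi z + t]addrC -subr_eq H.
have gB s : I s -> B (gamma s).
  by move=> /Igamma/ballE2[H1 H2]; apply/ballE2; split; lra.
have FE s t : I s -> F gamma (s, t) = gamma s + t *: g (gamma s).
  by move=> Is; rewrite /F /= derive1E; have [_ ->] := dgamma s Is.
pose U : set (R * R) := [set z | I z.1 /\ `|z.2| < r / 3].
pose h0 s := u (gamma s).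
have PhiE z : U z -> Phi gamma h0 z = (F gamma z, u (F gamma z)).
  move: z => [s t] [/= Is tr]; congr pair; rewrite (FE _ _ Is) /h /=.
  rewrite derive1E; have [_ ->] := dgamma s Is.
  rewrite (u_ruling oO u_C1 nonchar)// => x xt.
  have xr := le_lt_trans xt tr; split; first by apply: rO; exact: (line_in _ _ (gB s Is)).
  rewrite -[LHS]rot_perp -[RHS]rot_perp; congr rot.
  exact: (line_g _ _ (gB s Is)).
have FB s t : I s -> `|t| < r / 3 -> B (F gamma (s, t)).
  move=> Is tr; have [n1 n2] := gg _ (Br _ (gB s Is)).
  have /ballE2[b1 b2] := Igamma s Is; rewrite (FE _ _ Is); apply/ballE2.
  have H (x c w : R) : `|x - c| < r / 3 -> `|w| <= 1 -> `|x + t * w - c| < r / 3 + r / 3.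
    move=> xc w1; rewrite addrAC (le_lt_trans (ler_normD _ _))// normrM.
    have : `|t| * `|w| <= `|t| * 1 by apply: ler_wpM2l.
    lra.
  by split; exact: H.
have Fg s t : I s -> `|t| < r / 3 -> g (F gamma (s, t)) = g (gamma s).
  by move=> Is tr; rewrite (FE _ _ Is) (line_g _ _ (gB _ Is) tr).
have Fpsi s t : I s -> `|t| < r / 3 -> psi (F gamma (s, t)) = psi z0 + t.
  by move=> Is tr; rewrite (FE _ _ Is) (line_psi _ _ (gB _ Is) tr) psig.
have oU : open U.
  apply: (@openI _ [set z : R * R | I z.1] [set z : R * R | `|z.2| < r / 3]).
    by apply: (open_comp (f := fst)) => // z _; exact: cvg_fst.
  rewrite (_ : [set z : R * R | _] = snd @^-1` (ball (0 : R) (r / 3))); last first.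
    by apply/seteqP; split=> z; rewrite /ball /= sub0r normrN.
  by apply: open_comp => [z _|]; [exact: cvg_snd|exact: (@ball_open R R)].
have cg z : ball z0 r z -> {for z, continuous g} by move=> /C[].
have cpsi z : ball z0 r z -> {for z, continuous psi}.
  by move=> zr; exact: (C1_continuous (@open_ball _ z0 r) C zr).
have openF V : open V -> V `<=` U -> open (F gamma @` V).
  move=> oV VU; rewrite openE => z1 [[s1 t1] Vst Fz1].
  have [/= Is1 t1r] := VU _ Vst.
  have Bz1 : B z1 by rewrite -Fz1; exact: FB.
  have z1r := Br _ Bz1.
  pose tau z := psi z - psi z0.
  (* Going back along the ruling by the excess of psi leads to the level curve, so [lam (pi z)] and
     [tau z] are continuous candidates for the two parameters. *)
  pose pi z := z - tau z *: g z.
  have tau1 : tau z1 = t1 by rewrite /tau -Fz1 (Fpsi _ _ Is1 t1r) addrC addKr.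
  have gz1 : g z1 = g (gamma s1) by rewrite -Fz1 (Fg _ _ Is1 t1r).
  have pi1 : pi z1 = gamma s1.
    by rewrite /pi tau1 gz1 -Fz1 (FE _ _ Is1) addrK.
  have [_ _ _ Ns1 lams1] := IP s1 Is1.
  have ctau : tau @ z1 --> t1.
    by rewrite -tau1; apply: cvgB; [exact: cpsi|exact: cvg_cst].
  have cpi : pi @ z1 --> gamma s1.
    by rewrite -pi1; apply: cvgB; [exact: cvg_id|apply: cvgZ; [rewrite tau1|exact: cg]].
  have clp : (fun z => lam (pi z)) @ z1 --> s1.
    by rewrite -lams1; exact: (cvg_comp _ _ cpi (clam _)).
  have NB : \forall z \near z1, B z.
    by apply: open_nbhs_nbhs; split=> //; exact: open_ball.
  have Ntau : \forall z \near z1, `|tau z| < r / 3.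
    have ctn : (fun z => `|tau z|) @ z1 --> `|t1| by exact: cvg_norm.
    by move/cvgr_lt: ctn; apply.
  have NN : \forall z \near z1, N (pi z).
    by apply: cpi; exact: open_nbhs_nbhs.
  have NV : \forall z \near z1, V (lam (pi z), tau z).
    have cst : (fun z => (lam (pi z), tau z)) @ z1 --> (s1, t1).
      exact: (cvg_pair clp ctau).
    by apply: cst; exact: open_nbhs_nbhs.
  near=> z.
  have Bz : B z by near: z.
  have tz : `|tau z| < r / 3 by near: z.
  have Nz : N (pi z) by near: z.
  have Vz : V (lam (pi z), tau z) by near: z.
  exists (lam (pi z), tau z) => //.
  have ntz : `|- tau z| < r / 3 by rewrite normrN.
  have piE : pi z = z + (- tau z) *: g z by rewrite scaleNr.
  have psipi : psi (pi z) = psi z0.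
    by rewrite piE (line_psi _ _ Bz ntz) /tau; ring.
  have [Il gl] := NP _ Nz psipi.
  rewrite (FE _ _ Il) gl.
  have -> : g (pi z) = g z by rewrite piE (line_g _ _ Bz ntz).
  by rewrite /pi subrK.
exists I, gamma, h0, U; split.
  split.
  - by split=> // s Is; split; [apply: rO; exact: Br (gB s Is)|exact: dgamma].
  - by move=> z [].
  - by move=> s Is; split=> //=; rewrite normr0.
  split; first exact: oU.
  - move=> [s t] Ust; have [/= Is tr] := Ust.
    have NU : \forall z \near (s, t), U z by exact: open_nbhs_nbhs.
    pose F1 z := gamma z.1 + z.2 *: g (gamma z.1).
    have NE : {near (s, t), (fun z => (F1 z, u (F1 z))) =1 Phi gamma h0}.
      by apply: filterS NU => -[s' t'] Uz; rewrite (PhiE _ Uz) (FE _ _ Uz.1).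
    apply: (near_eq_continuous NE).
    have cgam : (fun z : R * R => gamma z.1) @ (s, t) --> gamma s.
      have cf : fst @ (s, t) --> s by exact: cvg_fst.
      exact: (cvg_comp _ _ cf (is_derive_continuous (dgamma s Is))).
    have cF1 : F1 @ (s, t) --> F1 (s, t).
      have cs : snd @ (s, t) --> t by exact: cvg_snd.
      exact: (cvgD cgam (cvgZ cs (cvg_comp _ _ cgam (cg _ (Br _ (gB s Is)))))).
    have Ost : Omega (F1 (s, t)).
      rewrite -[F1 _]/(gamma s + t *: g (gamma s)) -(FE _ _ Is).
      by apply: rO; exact: Br (FB _ _ Is tr).
    have cu : {for F1 (s, t), continuous u} by case: u_C1 => cu _; exact: cu.
    exact: (cvg_pair cF1 (cvg_comp _ _ cF1 cu)).
  (* Psi determines the position on the ruling and [g] its direction; subtracting gives the point of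
     the level curve, and [lam] its parameter. *)
  - move=> [s t] [s' t'] /set_mem Ust /set_mem Ust' PP.
    have FF : F gamma (s, t) = F gamma (s', t') := congr1 fst PP.
    have [/= Is tr] := Ust; have [/= Is' tr'] := Ust'.
    have tt : t = t'.
      apply: (addrI (psi z0)).
      exact: etrans (esym (Fpsi s t Is tr)) (etrans (congr1 psi FF) (Fpsi s' t' Is' tr')).
    have gg' : g (gamma s) = g (gamma s').
      exact: etrans (esym (Fg s t Is tr)) (etrans (congr1 g FF) (Fg s' t' Is' tr')).
    have : gamma s = gamma s'.
      have := etrans (esym (FE s t Is)) (etrans FF (FE s' t' Is')).
      by rewrite gg' tt => /addIr.
    have [_ _ _ _ ls] := IP s Is; have [_ _ _ _ ls'] := IP s' Is'.
    by move=> gs; rewrite tt -ls gs ls'.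
  (* On [U] the chart is [F] followed by the graph map of [u], so its image of [V] is cut out of the
     graph by the cylinder over the open image of [V] under [F]. *)
  - move=> V oV VU; exists [set w | (F gamma @` V) w.1].
      apply: (@open_comp _ _ fst) => [w _|]; first exact: cvg_fst.
      exact: openF.
    apply/seteqP; split=> [_ [z Vz <-]|[z' t] [[/= Oz' ->] [z Vz Fz]]].
      have Uz := VU z Vz; rewrite (PhiE _ Uz); split; last by exists z.
      split=> //=; apply: rO; apply: Br.
      by move: z Uz {Vz} => [s' t'] [/= Is' tr']; exact: FB.
    by exists z => //; rewrite PhiE ?Fz//; exact: VU.
exists (0, 0); first by split=> //=; rewrite normr0.
rewrite PhiE; last by split=> //=; rewrite normr0.
by rewrite (FE _ _ I0) scale0r addr0 g0.
Unshelve. all: by end_near. Qed.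

Theorem theorem1 (R : realType) (Omega : set (R * R)) (u : R * R -> R)
    (Omega_domain : domain Omega)
    (u_C1 : Cn 1 Omega u)
    (no_characteristic : forall z, Omega z -> ~ characteristic u z)
    (u_Hminimal : Hminimal Omega u)
    (pbar_W11 : W11 Omega (pbar u))
    (qbar_W11 : W11 Omega (qbar u)) :
  [/\ forall (I : set R) (c : R -> R * R),
        integral_curve Omega (fun z => perp (nuX u z)) I c -> straight I c,
      forall P : R * R * R, graph_of Omega u P ->
        exists (I : set R) (gamma : R -> R * R) (h0 : R -> R) (U : set (R * R)),
          seed_parameterization Omega u I gamma h0 U /\
          (Phi gamma h0 @` U) P
    & forall (I : set R) (gamma : R -> R * R) (h0 : R -> R) (U : set (R * R)),
        seed_parameterization Omega u I gamma h0 U ->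
        forall eps : R, 0 < eps -> (eps%:E < thickness Omega I gamma)%E ->
          Cn 1 I h0 /\ Cn 2 I gamma].
Proof.
have [oO _ _] := Omega_domain; split.
- exact: (integral_curve_straight oO u_C1 no_characteristic u_Hminimal).
- exact: (local_seed_parameterization oO u_C1 no_characteristic u_Hminimal).
move=> I gamma h0 U H _ _ _; have [seed _ _ _] := H; split.
  apply: (height_C1 oO u_C1 no_characteristic seed).
  exact: seed_parameterization_height H.
exact: (seed_curve_C2 oO u_C1 no_characteristic u_Hminimal seed).
Qed.
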